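(* $$p_c^{\mathrm{site}}(\vec{\mathbb{Z}}^2)\le p_a^+(\vec{\mathbb{Z}}^2)\le\sqrt{p_c^{\mathrm{site}}(\vec{\mathbb{Z}}^2)}.$$
   Context: The directed lattice $\vec{\mathbb{Z}}^2$ has vertex set $\mathbb{Z}^2$ and edge set consisting of all directed edges $(x,y)$ such that $\{x,y\}$ is a nearest-neighbour edge of $\mathbb{Z}^2$ and $x_i\le y_i$ for $i=1,2$. For a directed graph $G=(V,\vec{E})$, an oriented bond percolation model is a probability measure $\mathrm{P}$ on $\{0,1\}^{\vec{E}}$ with the product $\sigma$-algebra ($\omega(e)=1$: $e$ open). $\mathrm{P}$ is 1-independent if the edge statuses in $F_1$ are independent of those in $F_2$ whenever $F_1,F_2$ are disjoint sets of edges at distance at least $1$ in the corresponding undirected graph (i.e. no edge of $F_1$ shares a vertex with an edge of $F_2$). $\mathrm{P}$ is positively associated if $\mathrm{P}[A_1\cap A_2]\ge\mathrm{P}[A_1]\mathrm{P}[A_2]$ for all events $A_1,A_2$ increasing in $\omega$ (coordinatewise order). $\mathrm{P}$ percolates if with positive probability there is a vertex from which infinitely many vertices are reachable by open directed paths. $\mathcal{P}_a(G,p)$ is the set of positively associated, 1-independent bond percolation models $\mathrm{P}$ on $G$ with $\mathrm{P}[\omega(e)=1]\ge p$ for all edges $e$, and $p_a^+(G):=\sup\{p:\ \exists\,\mathrm{P}\in\mathcal{P}_a(G,p)\text{ that does not percolate}\}$. $p_c^{\mathrm{site}}(G)$ is the supremum of all $p$ for which Bernoulli site percolation on $G$ (each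 vertex open independently with probability $p$) does not percolate, i.e. almost surely there is no vertex from which infinitely many vertices are reachable by directed paths all of whose vertices are open. *)

(* Defs.v *)
From HB Require Import structures.
From mathcomp Require Import all_boot all_order all_algebra.
From mathcomp Require Import all_classical all_reals all_analysis.

Set Implicit Arguments.
Unset Strict Implicit.
Unset Printing Implicit Defensive.

Import Order.TTheory GRing.Theory Num.Theory.
Local Open Scope classical_set_scope.
Local Open Scope ring_scope.

(* Countability of the vertex set makes the percolation events below
   measurable. *)
Record digraph := Digraph { vertex :> countType; arc : rel vertex }.

Definition edge (G : digraph) := {e : G * G | arc e.1 e.2}.

(* [<<s coordinate_events F >>] is the sigma-algebra generated by the
   coordinates in [F]; a generator {w i = 0} is the complement of {w i = 1}. *)
Definition coordinate_events (I : Type) (F : set I) : set (set (I -> bool)) :=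
  [set [set w : I -> bool | w i] | i in F].

Definition config (I : Type) := g_sigma_algebraType (@coordinate_events I setT).

Definition increasing_event (I : Type) (A : set (config I)) :=
  forall w w' : config I, (forall i, w i -> w' i) -> A w -> A w'.

Definition share_vertex (G : digraph) (e f : edge G) : Prop :=
  [\/ (val e).1 = (val f).1, (val e).1 = (val f).2,
      (val e).2 = (val f).1 | (val e).2 = (val f).2].

Definition one_independent (R : realType) (G : digraph)
    (P : probability (config (edge G)) R) :=
  forall F1 F2 : set (edge G), F1 `&` F2 = set0 ->
    (forall e f, F1 e -> F2 f -> ~ share_vertex e f) ->
    forall A1 A2 : set (config (edge G)),
      <<s coordinate_events F1 >> A1 -> <<s coordinate_events F2 >> A2 ->
      P (A1 `&` A2) = (P A1 * P A2)%E.

Definition positively_associated (R : realType) (G : digraph)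
    (P : probability (config (edge G)) R) :=
  forall A1 A2 : set (config (edge G)),
    measurable A1 -> measurable A2 ->
    increasing_event A1 -> increasing_event A2 ->
    (P A1 * P A2 <= P (A1 `&` A2))%E.

Definition open_arc (G : digraph) (w : config (edge G)) : rel G :=
  fun x y => if insub (x, y) is Some e then w e else false.

Definition bond_reachable (G : digraph) (w : config (edge G)) (x : G) : set G :=
  [set y | exists2 s : seq G, path (open_arc w) x s & last x s = y].

Definition bond_percolation_event (G : digraph) : set (config (edge G)) :=
  [set w | exists x : G, infinite_set (bond_reachable w x)].

Definition bond_percolates (R : realType) (G : digraph)
    (P : probability (config (edge G)) R) : Prop :=
  (0 < P (@bond_percolation_event G))%E.

Definition Pa (R : realType) (G : digraph) (p : R)
    : set (probability (config (edge G)) R) :=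
  [set P | [/\ positively_associated P, one_independent P &
               forall e : edge G, (p%:E <= P [set w : config (edge G) | w e])%E]].

Definition pa_plus (R : realType) (G : digraph) : R :=
  sup [set p : R | 0 <= p <= 1 /\ exists2 P, @Pa R G p P & ~ bond_percolates P].

(* The values on cylinders determine [P] uniquely: it is the product over the
   vertices of the Bernoulli([p]) laws. *)
Definition bernoulli_site (R : realType) (G : digraph) (p : R)
    (P : probability (config G) R) :=
  forall (s : seq G) (a : G -> bool), uniq s ->
    P [set w : config G | forall v, v \in s -> w v = a v] =
      (\prod_(v <- s) (if a v then p else 1 - p))%:E.

(* A closed starting vertex reaches nothing, not even itself. *)
Definition site_reachable (G : digraph) (w : config G) (x : G) : set G :=
  [set y | exists s : seq G,
    [/\ path (@arc G) x s, all w (x :: s) & last x s = y]].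

Definition site_percolation_event (G : digraph) : set (config G) :=
  [set w | exists x : G, infinite_set (site_reachable w x)].

Definition pc_site (R : realType) (G : digraph) : R :=
  sup [set p : R | 0 <= p <= 1 /\
    exists2 P, @bernoulli_site R G p P & P (@site_percolation_event G) = 0%E].

Definition Z2_arc : rel (int * int) := fun x y =>
  [&& `|x.1 - y.1| + `|x.2 - y.2| == 1, x.1 <= y.1 & x.2 <= y.2].

Definition directed_Z2 : digraph := Digraph Z2_arc.

(* Main.v *)
(** For the lower bound, declare an edge open when its tail is open in Bernoulli
    site percolation: this model is 1-independent, it is positively associated
    by Harris' inequality, and its clusters are those of the site model up to
    their outer boundary.

    For the upper bound, let [P] be associated and 1-independent with marginals
    at least [p]. An edge [e] is open with conditional probability at least [p]
    given that some edges are open and others closed, provided that no closed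
    one shares a vertex with [e]. One can explore the cluster of a vertex line
    by line so that this proviso always holds: every new vertex is tested
    through a single edge, and an edge is only tested from a vertex no closed
    edge of which has been seen. The explored set then dominates what is obtained
    by giving every vertex two independent coins of bias [p], one for entering and
    one for leaving it, that is, Bernoulli site percolation of parameter [p^2]. *)

Require Import Defs.
From HB Require Import structures.
From mathcomp Require Import all_boot all_order all_algebra.
From mathcomp Require Import all_classical all_reals all_analysis.
From mathcomp Require Import measurable_realfun zify ring lra.
Import Order.TTheory GRing.Theory Num.Theory.
Set Implicit Arguments.
Unset Strict Implicit.
Unset Printing Implicit Defensive.
Local Open Scope classical_set_scope.
Local Open Scope ring_scope.

(** * Survival probabilities of the exploration and of site percolation *)

(** [all2] fails on sequences of different lengths, so only lines of equal length are comparable. *)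
Definition seq_le (s t : seq bool) := all2 implb s t.

Definition seq_mono (R : realType) (h : seq bool -> R) :=
  forall s t, seq_le s t -> h s <= h t.

Lemma seq_le_refl s : seq_le s s.
Proof. by elim: s => //= b s; rewrite /seq_le /= implybb. Qed.

Lemma seq_mono_cons (R : realType) (h : seq bool -> R) b :
  seq_mono h -> seq_mono (h \o cons b).
Proof. by move=> hm s t st; apply: hm; rewrite /seq_le /= implybb. Qed.

Lemma seq_mono_cons_le (R : realType) (h : seq bool -> R) s :
  seq_mono h -> h (false :: s) <= h (true :: s).
Proof. by move=> hm; apply: hm; rewrite /seq_le /=; exact: seq_le_refl. Qed.

Lemma seq_mono_has (R : realType) : seq_mono (fun s => (has id s)%:R : R).
Proof.
move=> s t st; rewrite ler_nat; suff : has id s ==> has id t by do 2!case: has.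
elim: s t st => [|b s IH] [|c t] //=; rewrite /seq_le /= => /andP[bc /IH].
by case: b bc; case: c => //= _; rewrite implybT.
Qed.

Lemma le_mix (R : realType) (p x y x' y' : R) : 0 <= p <= 1 ->
  x <= x' -> y <= y' -> p * x + (1 - p) * y <= p * x' + (1 - p) * y'.
Proof.
by move=> /andP[p0 p1] xx yy; rewrite lerD// ler_wpM2l// subr_ge0.
Qed.

Lemma le_mixr (R : realType) (p x y z : R) : 0 <= p <= 1 ->
  z <= x -> z <= y -> z <= p * x + (1 - p) * y.
Proof. by move=> p01 zx zy; have := le_mix p01 zx zy; lra. Qed.

(** This is the expectation of [h] at the random sequence that keeps each [true] of [s]
    independently with probability [r]. *)
Fixpoint thin (R : realType) (r : R) (s : seq bool) (h : seq bool -> R) : R :=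
  if s is b :: s' then
    if b then r * thin r s' (h \o cons true)
              + (1 - r) * thin r s' (h \o cons false)
    else thin r s' (h \o cons false)
  else h [::].

(* Position [i] of a line leads to the positions [i] and [i.+1] of the next
   line, which is one longer; [c] tells whether the position before the first
   one is occupied. *)
Fixpoint children (c : bool) (s : seq bool) : seq bool :=
  if s is b :: s' then (c || b) :: children b s' else [:: c].

(* Exploration of the next line from left to right, one edge per vertex: [c]
   tells whether the previous vertex of [s] may still be used. As long as it may
   not, the edge tested is the one from the current vertex, which is abandoned
   if the test fails; after a success, the next vertices are tested from their
   left neighbour, until the first gap of [s]. *)
Fixpoint sweep (R : realType) (p : R) (c : bool) (s : seq bool)
    (h : seq bool -> R) : R :=
  match s with
  | [::] => if c then p * h [:: true] + (1 - p) * h [:: false]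
            else h [:: false]
  | b :: s' =>
    if c then p * sweep p b s' (h \o cons true)
              + (1 - p) * sweep p b s' (h \o cons false)
    else if b then p * sweep p true s' (h \o cons true)
                   + (1 - p) * sweep p false s' (h \o cons false)
    else sweep p false s' (h \o cons false)
  end.

(* Probability of surviving [k] more levels, when the vertices of [s] have been
   reached ([bond_value]), respectively when they have an open parent but their
   own state is unknown ([site_value]). *)
Fixpoint bond_value (R : realType) (p : R) (k : nat) : seq bool -> R :=
  if k is k'.+1 then fun s => sweep p false s (bond_value p k')
  else fun s => (has id s)%:R.

Fixpoint site_value (R : realType) (q : R) (k : nat) : seq bool -> R :=
  if k is k'.+1 then
    fun s => thin q s (fun t => site_value q k' (children false t))
  else fun s => thin q s (fun t => (has id t)%:R).

Section values.
Context (R : realType) (p : R) (p01 : 0 <= p <= 1).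
Implicit Types (h : seq bool -> R) (s t : seq bool).

Lemma thin_le r s h h' : 0 <= r <= 1 -> (forall y, h y <= h' y) ->
  thin r s h <= thin r s h'.
Proof.
move=> r01; elim: s h h' => [|[] s IH] h h' hh //=; last first.
  by apply: IH => y; exact: hh.
by apply: le_mix => //; apply: IH => y; exact: hh.
Qed.

Lemma thin_linear r s a b h h' :
  thin r s (fun y => a * h y + b * h' y) = a * thin r s h + b * thin r s h'.
Proof.
elim: s h h' => [|[] s IH] h h' //=; last exact: IH.
by rewrite (IH (h \o cons true) (h' \o cons true))
  (IH (h \o cons false) (h' \o cons false)); ring.
Qed.

Lemma thin_thin s h : thin p s (fun y => thin p y h) = thin (p * p) s h.
Proof.
elim: s h => [|[] s IH] h //=; last exact: (IH (h \o cons false)).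
rewrite thin_linear (IH (h \o cons true)) (IH (h \o cons false)); ring.
Qed.

Lemma thin_le_id r s h : 0 <= r <= 1 -> seq_mono h -> thin r s h <= h s.
Proof.
move=> r01; elim: s h => [|[] s IH] h hm //=; last first.
  exact: (IH _ (seq_mono_cons false hm)).
have h1 := IH _ (seq_mono_cons true hm).
have h0 := IH _ (seq_mono_cons false hm).
have /= := seq_mono_cons_le s hm; move: h1 h0 => /= h1 h0 h01.
have := le_mix r01 h1 (le_trans h0 h01); lra.
Qed.

(** The larger sweep performs the tests of the smaller one and perhaps more. At an additional test
    both outcomes dominate the untested [false]; for a success this is [J], where [h'] has to be
    monotone. *)
Lemma sweep_le c c' s s' h h' : seq_mono h -> seq_mono h' ->
  (forall y, h y <= h' y) -> c ==> c' -> seq_le s s' ->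
  sweep p c s h <= sweep p c' s' h'.
Proof.
elim: s s' c c' h h' => [|b s IH] [|b' s'] c c' h h' hm hm' hh //.
  move=> cc _; have hh0 := hh [:: false]; have hh1 := hh [:: true].
  have /= h01 := seq_mono_cons_le [::] hm'.
  case: c c' cc => [] [] //= _; first exact: le_mix.
  by apply: le_mixr => //; exact: le_trans h01.
rewrite /seq_le /= => cc /andP[bb ss].
have m x := seq_mono_cons x hm; have m' x := seq_mono_cons x hm'.
have I x d d' : d ==> d' ->
    sweep p d s (h \o cons x) <= sweep p d' s' (h' \o cons x).
  by move=> dd; apply: IH => // y; exact: hh.
have J d d' : d ==> d' ->
    sweep p d s (h \o cons false) <= sweep p d' s' (h' \o cons true).
  move=> dd; apply: IH => // y; apply: (le_trans (hh _)).
  exact: seq_mono_cons_le.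
case: c c' b b' cc bb {IH} => [] [] [] [] //= _ _;
  by [apply: le_mix => //; exact: I | apply: le_mixr => //; [exact: J|exact: I]
     | exact: I].
Qed.

Lemma bond_value_mono k : seq_mono (bond_value p k).
Proof.
elim: k => [|k IH] /=; first exact: seq_mono_has.
by move=> s t st; apply: sweep_le.
Qed.

(** On the left, every vertex of [s] has an outgoing coin, then every child an incoming one. The
    sweep replays at most one coin per position: a left edge is the outgoing coin of the current
    vertex, a right edge the incoming coin of the new vertex. The other coins are conceded to the
    sweep. Here [c] tells whether the previous vertex passed its outgoing coin. *)
Lemma thin_children_le_sweep c c' s h : seq_mono h -> c ==> c' ->
  thin p s (fun y => thin p (children c y) h) <= sweep p c' s h.
Proof.
elim: s c c' h => [|b s IH] c c' h hm cc /=.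
  have /= h01 := seq_mono_cons_le [::] hm.
  by case: c c' cc => [] [] //= _; exact: le_mixr.
have m x := seq_mono_cons x hm.
have I x d d' : d ==> d' ->
    thin p s (fun y => thin p (children d y) (h \o cons x)) <=
    sweep p d' s (h \o cons x) by move=> dd; exact: IH.
have J d d' : d ==> d' ->
    thin p s (fun y => thin p (children d y) (h \o cons false))
    <= sweep p d' s (h \o cons true).
  move=> /(I false) /le_trans; apply; apply: (sweep_le (m _) (m _)).
  - by move=> y; exact: seq_mono_cons_le.
  - exact: implybb.
  - exact: seq_le_refl.
have p1 : 0 <= 1 - p by case/andP: p01 => *; rewrite subr_ge0.
case: b => /=; case: c c' cc => [] [] //= _; rewrite ?thin_linear.
- have I11 := I true true true isT; have I10 := I false true true isT.
  have I01 := I true false true isT; have I00 := I false false true isT.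
  have := le_mix p01 (le_mix p01 I11 I10) (le_mix p01 I01 I00); lra.
- have I11 := I true true true isT; have I10 := I false true true isT.
  have J0 := J false true isT; have I00 := I false false true isT.
  have := le_mix p01 (le_mix p01 I11 I10) (le_mixr p01 J0 I00); lra.
(* Left test: after a successful outgoing coin the sweep occupies the child even if the incoming
   coin of the child fails, which is [J0]. *)
- have I11 := I true true true isT; have J0 := J true true isT.
  have I00 := I false false false isT.
  apply: le_mix => //; have := le_mix p01 I11 J0; lra.
- by apply: le_mix p01 _ _; exact: I.
- by apply: le_mixr p01 _ _; [exact: J|exact: I].
- exact: I.
Qed.

(* A vertex that is open with probability [p * p] amounts to two independent
   coins of bias [p], one for its incoming and one for its outgoing edges. *)
Lemma site_value_le_thin k s :
  site_value (p * p) k s <= thin p s (bond_value p k).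
Proof.
elim: k s => [|k IH] s /=; rewrite -thin_thin; apply: thin_le => // y.
  exact: (thin_le_id y p01 (@seq_mono_has R)).
(* The induction hypothesis leaves an incoming coin for each child; together with the outgoing coins
   of [y] these are what one sweep absorbs. *)
apply: (@le_trans _ _ (thin p y (fun t =>
    thin p (children false t) (bond_value p k)))).
  by apply: thin_le => // t; exact: IH.
by apply: thin_children_le_sweep => //; exact: bond_value_mono.
Qed.

Lemma site_value_le_bond_value k s :
  site_value (p * p) k s <= bond_value p k s.
Proof.
apply: (le_trans (site_value_le_thin _ _)); apply: thin_le_id => //.
exact: bond_value_mono.
Qed.

End values.

(** * Measurability *)

Section real_probability.
Context d (T : measurableType d) (R : realType) (P : probability T R).
Implicit Types A B : set T.

Definition pr A : R := fine (P A).

Lemma prE A : measurable A -> P A = (pr A)%:E.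
Proof. by move=> mA; rewrite /pr fineK ?fin_num_measure. Qed.

Lemma pr_ge0 A : 0 <= pr A.
Proof. by rewrite fine_ge0. Qed.

Lemma pr_setT : pr setT = 1.
Proof. by rewrite /pr probability_setT. Qed.

Lemma pr_set0 : pr set0 = 0.
Proof. by rewrite /pr measure0. Qed.

Lemma pr_le A B : measurable A -> measurable B -> A `<=` B -> pr A <= pr B.
Proof.
move=> mA mB AB; rewrite -lee_fin -!prE//.
by apply: le_measure; rewrite ?inE.
Qed.

Lemma pr_le1 A : measurable A -> pr A <= 1.
Proof. by move=> mA; rewrite -pr_setT; exact: pr_le. Qed.

Lemma prU A B : measurable A -> measurable B -> A `&` B = set0 ->
  pr (A `|` B) = pr A + pr B.
Proof.
move=> mA mB AB; apply: EFin_inj; rewrite EFinD -!prE//;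
  last exact: measurableU.
by rewrite measureU.
Qed.

Lemma pr_split A B : measurable A -> measurable B ->
  pr A = pr (A `&` B) + pr (A `&` ~` B).
Proof.
move=> mA mB; have mB' := measurableC mB.
rewrite -prU -?setIUr ?setUv ?setIT//; try exact: measurableI.
by rewrite setIACA setICr setI0.
Qed.

Lemma prC A : measurable A -> pr (~` A) = 1 - pr A.
Proof.
move=> mA; have := pr_split measurableT mA; rewrite pr_setT !setTI; lra.
Qed.

Lemma prD A B : measurable A -> measurable B -> B `<=` A ->
  pr (A `&` ~` B) = pr A - pr B.
Proof.
by move=> mA mB BA; have := pr_split mA mB; rewrite (setIidr BA); lra.
Qed.

Lemma prUI A B : measurable A -> measurable B ->
  pr (A `|` B) = pr A + pr B - pr (A `&` B).
Proof.
move=> mA mB; have mU := measurableU _ _ mA mB.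
have := pr_split mU mB; rewrite setIC (setIidl (@subsetUr _ A B)).
rewrite setIUl setICr setU0 => ->; have := pr_split mA mB; lra.
Qed.

End real_probability.

Section configurations.
Context (I : Type).

Lemma measurable_coordinate (i : I) :
  measurable [set w : config I | w i].
Proof. by apply: sub_sigma_algebra; exists i. Qed.

Lemma coordinate_sigma_algebra_sub (F F' : set I) : F `<=` F' ->
  <<s coordinate_events F >> `<=` <<s coordinate_events F' >>.
Proof.
by move=> FF; apply: sub_sigma_algebra2; exact: image_subset.
Qed.

Lemma coordinate_sigma_algebra_measurable (F : set I) (A : set (config I)) :
  <<s coordinate_events F >> A -> measurable A.
Proof. exact: coordinate_sigma_algebra_sub. Qed.

End configurations.

Lemma measurable_all d (T : measurableType d) (J : eqType) (s : seq J)
    (f : J -> T -> bool) : (forall j, j \in s -> measurable [set w | f j w]) ->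
  measurable [set w | all (f^~ w) s].
Proof.
elim: s => [|j s IH] fm.
  by rewrite [X in measurable X](_ : _ = setT) //; apply/seteqP; split.
rewrite [X in measurable X](_ : _ =
    [set w | f j w] `&` [set w | all (f^~ w) s]); last first.
  by apply/seteqP; split => [w /andP[]|w [/= -> ->]].
apply: measurableI; first by apply: fm; rewrite mem_head.
by apply: IH => k ks; apply: fm; rewrite inE ks orbT.
Qed.

Lemma measurable_neg d (T : measurableType d) (f : T -> bool) :
  measurable [set w | f w] -> measurable [set w | ~~ f w].
Proof.
move=> mf; rewrite [X in measurable X](_ : _ = ~` [set w | f w]).
  exact: measurableC.
by apply/seteqP; split => w /= /negP.
Qed.

Lemma measurable_exists d (T : measurableType d) (J : countType)
    (F : J -> set T) : (forall j, measurable (F j)) ->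
  measurable [set w | exists j, F j w].
Proof.
move=> mF; rewrite [X in measurable X](_ : _ = \bigcup_j F j).
  exact: (countable_bigcupT_measurable (countableP _)).
by apply/seteqP; split => w [j]; [exists j|move=> _; exists j].
Qed.

Lemma measurable_forall d (T : measurableType d) (J : countType)
    (F : J -> set T) : (forall j, measurable (F j)) ->
  measurable [set w | forall j, F j w].
Proof.
move=> mF; rewrite [X in measurable X](_ : _ =
    ~` [set w | exists j, (~` F j) w]).
  by apply/measurableC/measurable_exists => j; exact: measurableC.
apply/seteqP; split => w /=; first by move=> Fw [j]; apply.
by move=> Fw j; apply: contrapT => Fj; apply: Fw; exists j.
Qed.

(** Only finitely many elements have a code below a given bound. This form uses countable
    quantifiers only, whence the measurability of the percolation events. *)
Lemma infinite_setP (T : countType) (A : set T) :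
  infinite_set A <-> forall n, exists y : T, A y /\ (n <= pickle y)%N.
Proof.
split=> [Ainf n|An Afin].
  apply: contrapT => nex; apply: Ainf.
  have An y : A y -> (pickle y < n)%N.
    by move=> Ay; rewrite ltnNge; apply/negP => ny; apply: nex; exists y.
  apply: (@sub_finite_set _ _ (pickle @^-1` `I_n)) => [y /An //|].
  apply: finite_preimage => // y z _ _; exact: (pcan_inj pickleK).
have /finite_seqP[s As] := Afin.
have [y [Ay]] := An (\max_(x <- s) pickle x).+1.
rewrite ltnNge => /negP; apply; move: Ay; rewrite As /= => ys.
by rewrite (big_rem y) //= leq_maxl.
Qed.

Lemma measurable_infinite d (T : measurableType d) (J : countType)
    (F : T -> set J) : (forall y, measurable [set w | F w y]) ->
  measurable [set w | infinite_set (F w)].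
Proof.
move=> mF; rewrite [X in measurable X](_ : _ =
  [set w | forall n, exists y : J, F w y /\ (n <= pickle y)%N]).
  apply: measurable_forall => n; apply: measurable_exists => y.
  have [ny|ny] := leqP n (pickle y).
    rewrite [X in measurable X](_ : _ = [set w | F w y])//.
    by apply/seteqP; split => w /= => [[]|].
  rewrite [X in measurable X](_ : _ = set0)//.
  by apply/seteqP; split => w //= => [[]].
by apply/seteqP; split => w /= /infinite_setP.
Qed.

Section bond_measurability.
Context (G : digraph).

Lemma measurable_open_arc (x y : G) :
  measurable [set w : config (edge G) | open_arc w x y].
Proof.
rewrite /open_arc; case: insubP => [e _ _|_].
  exact: measurable_coordinate.
by rewrite [X in measurable X](_ : _ = set0) //; apply/seteqP; split.
Qed.

Lemma measurable_path d (T : measurableType d) (e : T -> rel G) x s :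
  (forall x y, measurable [set w | e w x y]) ->
  measurable [set w | path (e w) x s].
Proof.
move=> me; elim: s x => [|y s IH] x.
  by rewrite [X in measurable X](_ : _ = setT) //; apply/seteqP; split.
rewrite [X in measurable X](_ : _ =
    [set w | e w x y] `&` [set w | path (e w) y s]).
  exact: measurableI.
by apply/seteqP; split => [w /andP[]|w [/= -> ->]].
Qed.

Lemma measurable_bond_reachable (x y : G) :
  measurable [set w : config (edge G) | bond_reachable w x y].
Proof.
rewrite [X in measurable X](_ : _ = [set w : config (edge G) |
    exists s : seq G, path (open_arc w) x s /\ last x s = y]).
  apply: measurable_exists => s; have [xy|xy] := pselect (last x s = y).
    rewrite [X in measurable X](_ : _ =
        [set w : config (edge G) | path (open_arc w) x s]).
      by apply: measurable_path => u v; exact: measurable_open_arc.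
    by apply/seteqP; split => w /= => [[]|].
  rewrite [X in measurable X](_ : _ = set0)//.
  by apply/seteqP; split => w //= => [[]].
by apply/seteqP; split => w /= [s]; [exists s|case; exists s].
Qed.

Lemma measurable_bond_percolation_event :
  measurable (@bond_percolation_event G).
Proof.
apply: measurable_exists => x; apply: measurable_infinite => y.
exact: measurable_bond_reachable.
Qed.

Lemma measurable_site_reachable (x y : G) :
  measurable [set w : config G | site_reachable w x y].
Proof.
apply: measurable_exists => s.
have [[sx xy]|nxy] := pselect (path (@Defs.arc G) x s /\ last x s = y).
  rewrite [X in measurable X](_ : _ =
      [set w : config G | all (fun v => w v) (x :: s)]).
    by apply: measurable_all => v _; exact: measurable_coordinate.
  by apply/seteqP; split => w /= => [[]|].
rewrite [X in measurable X](_ : _ = set0)//.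
by apply/seteqP; split => w //= [? ? ?]; apply: nxy.
Qed.

Lemma measurable_site_percolation_event :
  measurable (@site_percolation_event G).
Proof.
apply: measurable_exists => x; apply: measurable_infinite => y.
exact: measurable_site_reachable.
Qed.

End bond_measurability.

(** * Exploration of a positively associated 1-independent model *)

Section conditioning.
Context (G : digraph).
Implicit Types (O C : seq (edge G)) (e f : edge G).

Definition history O C : set (config (edge G)) :=
  [set w | all (fun f => w f) O && all (fun f => ~~ w f) C].

Lemma history_setI O C : history O C =
  [set w : config (edge G) | all (fun f => w f) O] `&`
  [set w : config (edge G) | all (fun f => ~~ w f) C].
Proof. by apply/seteqP; split => [w /andP[]|w [? ?]] //; apply/andP. Qed.

Lemma measurable_history O C : measurable (history O C).
Proof.
rewrite history_setI; apply: measurableI; apply: measurable_all => f _.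
  exact: measurable_coordinate.
apply: measurable_neg; exact: measurable_coordinate.
Qed.

Lemma history_open O C e :
  history (e :: O) C = history O C `&` [set w | w e].
Proof.
apply/seteqP; split => w /=; rewrite /history /=.
  by move=> /andP[/andP[-> ->] ->].
by move=> [/andP[-> ->] ->].
Qed.

Lemma history_closed O C e :
  history O (e :: C) = history O C `&` ~` [set w | w e].
Proof.
apply/seteqP; split => w /=; rewrite /history /=.
  by move=> /andP[-> /andP[/negP ? ->]].
by move=> [/andP[-> ->]] /negP ->.
Qed.

(* With [A] = {e open}, [I] = {O open} and [D] = {C closed}, association for
   the increasing events [A] and [I `|` ~` D], minus the identity
   [P (A `&` ~` D) = P A * P (~` D)] given by 1-independence, is
   [P A * P (I `&` D) <= P (A `&` I `&` D)]. *)
Lemma open_given_history (R : realType) (P : probability (config (edge G)) R)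
    (p : R) O C e : Pa p P -> (forall f, f \in C -> ~ share_vertex e f) ->
  p * pr P (history O C) <= pr P (history O C `&` [set w | w e]).
Proof.
move=> [PA indep marg] Ce; set A := [set w : config (edge G) | w e].
pose I := [set w : config (edge G) | all (fun f => w f) O].
pose D := [set w : config (edge G) | all (fun f => ~~ w f) C].
have mA : measurable A := measurable_coordinate e.
have mI : measurable I.
  by apply: measurable_all => f _; exact: measurable_coordinate.
(* Independence requires [D] to lie in the sigma-algebra of the edges of [C], which is finer
   information than measurability. *)
have sD : <<s coordinate_events [set` C] >> D.
  apply: (@measurable_all _ (g_sigma_algebraType (coordinate_events [set` C])))
    => f fC.
  apply: (@measurable_neg _ (g_sigma_algebraType (coordinate_events [set` C]))).
  by apply: sub_sigma_algebra; exists f.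
have mD : measurable D := coordinate_sigma_algebra_measurable sD.
have mD' := measurableC mD.
have sA : <<s coordinate_events [set e] >> A.
  by apply: sub_sigma_algebra; exists e.
have mU : measurable (I `|` ~` D) by exact: measurableU.
have inA : increasing_event A by move=> w w' ww; exact: ww.
have inU : increasing_event (I `|` ~` D).
  move=> w w' ww [/allP wI|wD]; [left|right].
    by apply/allP => f /wI; exact: ww.
  move=> w'D; apply: wD; apply/allP => f /(allP w'D).
  by apply: contra; exact: ww.
have AU := PA _ _ mA mU inA inU.
have AD : P (A `&` D) = (P A * P D)%E.
  apply: (indep [set e] [set` C]) => //; last by move=> _ f -> fC; exact: Ce.
  (* An edge shares a vertex with itself, so [e] is not in [C]. *)
  apply/seteqP; split => f //= [-> eC]; apply: (Ce _ eC); exact: Or41.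
have mAU := measurableI _ _ mA mU; have mAD := measurableI _ _ mA mD.
move: AU AD; rewrite history_setI -/I -/D !(prE P)// -!EFinM lee_fin => AU [AD].
have pA : p <= pr P A by rewrite -lee_fin -prE//; exact: marg.
have h0 := pr_ge0 P (I `&` D).
have := prC P mD; have := pr_split P mU mD; have := pr_split P mAU mD.
have := pr_split P mA mD.
have -> : (I `|` ~` D) `&` D = I `&` D by apply/seteqP; split => w /=; tauto.
have -> : (I `|` ~` D) `&` ~` D = ~` D by apply/seteqP; split => w /=; tauto.
have -> : A `&` (I `|` ~` D) `&` D = I `&` D `&` A.
  by apply/seteqP; split => w /=; tauto.
have -> : A `&` (I `|` ~` D) `&` ~` D = A `&` ~` D.
  by apply/seteqP; split => w /=; tauto.
rewrite AD => e1 e2 e3 e4; apply: (le_trans (ler_wpM2r h0 pA)).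
by move: AU; rewrite e2 e3 e4; lra.
Qed.

End conditioning.

(** In these coordinates [m] numbers the antidiagonals above [x]. Both arcs leaving a vertex go to
    the next antidiagonal: the vertical one keeps [i], the horizontal one increases it by 1. *)
Definition lattice_point (x : int * int) (m i : nat) : directed_Z2 :=
  (x.1 + i%:Z, x.2 + m%:Z - i%:Z).

Lemma lattice_point_inj x m i m' i' :
  lattice_point x m i = lattice_point x m' i' -> m = m' /\ i = i'.
Proof.
move=> e; have := congr1 (fun z : int * int => z.1) e.
by have := congr1 (fun z : int * int => z.2) e => /= e2 e1; split; lia.
Qed.

Lemma arc_left x m i :
  Z2_arc (lattice_point x m i) (lattice_point x m.+1 i).
Proof. by rewrite /Z2_arc /=; apply/and3P; split; lia. Qed.

Lemma arc_right x m i :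
  Z2_arc (lattice_point x m i) (lattice_point x m.+1 i.+1).
Proof. by rewrite /Z2_arc /=; apply/and3P; split; lia. Qed.

Lemma arc_lattice_point x m i (y : int * int) :
  Z2_arc (lattice_point x m i) y ->
  y = lattice_point x m.+1 i \/ y = lattice_point x m.+1 i.+1.
Proof.
case: y => y1 y2; rewrite /Z2_arc /lattice_point /= => /and3P[/eqP a b c].
have [e|e] : y1 = x.1 + i%:Z \/ y1 = x.1 + i.+1%:Z by lia.
  by left; congr pair; lia.
by right; congr pair; lia.
Qed.

Lemma path_lattice_point (r : rel directed_Z2) x m i s :
  subrel r Z2_arc -> path r (lattice_point x m i) s ->
  exists2 j, last (lattice_point x m i) s = lattice_point x (m + size s) j
           & (i <= j <= i + size s)%N.
Proof.
move=> rZ; elim: s m i => [|y s IH] m i /=.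
  by exists i; rewrite addn0 // leqnn.
move=> /andP[/rZ/arc_lattice_point[] -> /IH[j -> /andP[ij ji]]];
  exists j; rewrite ?addSnnS //.
  by rewrite ij addnS leqW.
by rewrite (ltnW ij) -addSnnS.
Qed.

Lemma lattice_point0 (x : int * int) : lattice_point x 0 0 = x.
Proof. by case: x => a b; rewrite /lattice_point /= !addr0. Qed.

Section bond_exploration.
Context (R : realType) (P : probability (config (edge directed_Z2)) R) (p : R).
Context (Pp : Pa p P) (p01 : 0 <= p <= 1) (x : directed_Z2) (n : nat).
Local Notation V := (lattice_point x).
Local Notation edge := (edge directed_Z2).
Implicit Types (O C : seq edge) (u v : directed_Z2) (s acc : seq bool).

Definition reaches_level : set (config edge) :=
  [set w | exists j, bond_reachable w x (V n j)].

Lemma measurable_reaches_level : measurable reaches_level.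
Proof. by apply: measurable_exists => j; exact: measurable_bond_reachable. Qed.

Definition touched C u :=
  exists2 f : edge, f \in C & (val f).1 = u \/ (val f).2 = u.

(** The second condition is what allows an edge leaving [u] to be tested by [open_given_history]. *)
Definition live O C u :=
  (forall w, history O C w -> bond_reachable w x u) /\ ~ touched C u.

Lemma touched_cons (e : edge) C u : touched (e :: C) u ->
  [\/ u = (val e).1, u = (val e).2 | touched C u].
Proof.
move=> [f]; rewrite inE => /orP[/eqP -> [] <-|fC fu];
  by [constructor 1|constructor 2|constructor 3; exists f].
Qed.

Lemma touched_consW (e : edge) C u : ~ touched C u -> u <> (val e).1 ->
  u <> (val e).2 -> ~ touched (e :: C) u.
Proof. by move=> Cu u1 u2 /touched_cons[]. Qed.

Lemma live_open (e : edge) O C u : live O C u -> live (e :: O) C u.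
Proof. by move=> [Hu Cu]; split => // w; rewrite history_open => -[/Hu]. Qed.

Lemma live_closed (e : edge) O C u : live O C u -> u <> (val e).1 ->
  u <> (val e).2 -> live O (e :: C) u.
Proof.
move=> [Hu Cu] u1 u2; split; last exact: touched_consW.
by move=> w; rewrite history_closed => -[/Hu].
Qed.

Lemma live_target (e : edge) O C : live O C (val e).1 ->
  ~ touched C (val e).2 -> live (e :: O) C (val e).2.
Proof.
move=> [Hu Cu] Cv; split => // w; rewrite history_open => -[/Hu[s ps ls] we].
exists (rcons s (val e).2); rewrite ?last_rcons // rcons_path ps ls /=.
by rewrite /open_arc -surjective_pairing valK.
Qed.

(** Let [H] be the probability of the history and [H1] its part with [e] open. The two branches give
    at least [H * v0 + H1 * (v1 - v0)]. Since [v0 <= v1], the one-sided bound [p * H <= H1]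
    suffices. *)
Lemma explore_edge (e : edge) O C (v1 v0 : R) : live O C (val e).1 ->
  ~ touched C (val e).2 -> v0 <= v1 ->
  pr P (history (e :: O) C) * v1
    <= pr P (history (e :: O) C `&` reaches_level) ->
  pr P (history O (e :: C)) * v0
    <= pr P (history O (e :: C) `&` reaches_level) ->
  pr P (history O C) * (p * v1 + (1 - p) * v0)
    <= pr P (history O C `&` reaches_level).
Proof.
move=> [_ C1] C2 v01; rewrite history_open history_closed => h1 h0.
have mH := measurable_history O C; have me := measurable_coordinate e.
have mHG := measurableI _ _ mH measurable_reaches_level.
have := pr_split P mHG me; have := pr_split P mH me.
rewrite [_ `&` reaches_level `&` _]setIAC [_ `&` reaches_level `&` ~` _]setIAC.
move=> eH ->; apply: le_trans (lerD h1 h0).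
have : p * pr P (history O C) <=
    pr P (history O C `&` [set w : config edge | w e]).
  apply: (open_given_history _ Pp) => f fC [] fe.
  - by apply: C1; exists f => //; left.
  - by apply: C1; exists f => //; right.
  - by apply: C2; exists f => //; left.
  - by apply: C2; exists f => //; right.
move: eH; set H := pr P (history O C); set H1 := pr P _; set H0 := pr P _.
move=> eH pH; have v10 : 0 <= v1 - v0 by rewrite subr_ge0.
have := ler_wpM2r v10 pH; have -> : H0 = H - H1 by rewrite eH; ring.
lra.
Qed.

Definition left_edge m i : edge := exist _ (V m i, V m.+1 i) (arc_left x m i).
Definition right_edge m i : edge :=
  exist _ (V m i, V m.+1 i.+1) (arc_right x m i).

(** The second clause keeps all vertices of later levels available as targets of a test. *)
Definition level_state m s O C :=
  (forall j, nth false s j -> live O C (V m j)) /\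
  (forall k j, (m < k)%N -> ~ touched C (V k j)).

(* [acc] is the exploration of the first [i] vertices of level [m.+1], [s] the
   set of reached vertices of level [m] from the [i]-th one on. *)
Record sweep_state m i (c : bool) s acc O C : Prop := SweepState {
  sweep_here : forall j, nth false s j -> live O C (V m (i + j));
  sweep_prev : c -> (0 < i)%N /\ live O C (V m i.-1);
  sweep_next : forall j, (i <= j)%N -> ~ touched C (V m.+1 j);
  sweep_acc : forall j, nth false acc j -> live O C (V m.+1 j);
  sweep_size : size acc = i;
  sweep_far : forall k j, (m.+1 < k)%N -> ~ touched C (V k j) }.

Lemma neq_level m i m' i' : m <> m' -> V m i <> V m' i'.
Proof. by move=> mm /lattice_point_inj[]. Qed.

Lemma neq_index m i m' i' : i <> i' -> V m i <> V m' i'.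
Proof. by move=> ii /lattice_point_inj[]. Qed.

Lemma nth_rcons_false acc b j : nth false (rcons acc b) j ->
  nth false acc j \/ j = size acc /\ b.
Proof.
rewrite nth_rcons; case: ltngtP => // [_|-> bT]; [by left|by right].
Qed.

Lemma sweep_state_level m i acc O C :
  sweep_state m i false [::] acc O C -> level_state m.+1 acc O C.
Proof. by move=> [_ _ _ accl _ far]; split. Qed.

Lemma level_sweep_state m s O C :
  level_state m s O C -> sweep_state m 0 false s [::] O C.
Proof.
move=> [sl far]; split => //.
- by move=> j _; exact: far.
- by move=> j; rewrite nth_nil.
- by move=> k j mk; apply: far; exact: ltnW.
Qed.

(** The next level is one vertex longer. Its last vertex is handled by padding the current level
    with an unoccupied one. *)
Lemma sweep_state_nil m i c acc O C :
  sweep_state m i c [::] acc O C -> sweep_state m i c [:: false] acc O C.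
Proof.
by move=> [_ prev next accl sz far]; split => // -[|j] //=; rewrite nth_nil.
Qed.

Lemma sweep_state_skip m i s acc O C :
  sweep_state m i false (false :: s) acc O C ->
  sweep_state m i.+1 false s (rcons acc false) O C.
Proof.
move=> [here _ next accl sz far]; split => //.
- by move=> j sj; rewrite addSnnS; exact: here.
- by move=> j ij; apply: next; exact: ltnW.
- by move=> j /nth_rcons_false[/accl|[]].
- by rewrite size_rcons sz.
Qed.

Lemma sweep_state_left_open m i s acc O C :
  sweep_state m i false (true :: s) acc O C ->
  sweep_state m i.+1 true s (rcons acc true) (left_edge m i :: O) C.
Proof.
move=> [here _ next accl sz far]; split => //.
- by move=> j sj; apply: live_open; rewrite addSnnS; exact: here.
- by move=> _; split => //; apply: live_open; have := here 0 isT; rewrite addn0.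
- by move=> j ij; apply: next; exact: ltnW.
- move=> j /nth_rcons_false[/accl|[-> _]]; first exact: live_open.
  rewrite sz; apply: (@live_target (left_edge m i)); last exact: next.
  by have := here 0 isT; rewrite addn0.
- by rewrite size_rcons sz.
Qed.

(** Both endpoints of the closed edge are given up: its tail by the flag [false], its head by the
    entry [false] of [acc]. The occupied entries of [acc] have smaller indices and stay
    untouched. *)
Lemma sweep_state_left_closed m i s acc O C :
  sweep_state m i false (true :: s) acc O C ->
  sweep_state m i.+1 false s (rcons acc false) O (left_edge m i :: C).
Proof.
move=> [here _ next accl sz far]; split => //.
- move=> j sj; apply: live_closed; first by rewrite addSnnS; exact: here.
    by apply: neq_index; lia.
  by apply: neq_level; lia.
- move=> j ij; apply: touched_consW; first by apply: next; exact: ltnW.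
    by apply: neq_level; lia.
  by apply: neq_index; lia.
- move=> j /nth_rcons_false[accj|[]] //.
  have ji : (j < i)%N.
    by rewrite -sz; case: ltnP accj => // /(nth_default false) ->.
  apply: live_closed; first exact: accl.
    by apply: neq_level; lia.
  by apply: neq_index; lia.
- by rewrite size_rcons sz.
- move=> k j mk; apply: touched_consW; first exact: far.
    by apply: neq_level; lia.
  by apply: neq_level; lia.
Qed.

Lemma sweep_state_right_open m i b s acc O C :
  sweep_state m i.+1 true (b :: s) acc O C ->
  sweep_state m i.+2 b s (rcons acc true) (right_edge m i :: O) C.
Proof.
move=> [here /(_ isT)[_ prev] next accl sz far]; split => //.
- by move=> j sj; apply: live_open; rewrite addSnnS; exact: here.
- by move=> bT; split => //; apply: live_open; have := here 0 bT; rewrite addn0.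
- by move=> j ij; apply: next; exact: ltnW.
- move=> j /nth_rcons_false[/accl|[-> _]]; first exact: live_open.
  by rewrite sz; apply: (@live_target (right_edge m i)) => //; exact: next.
- by rewrite size_rcons sz.
Qed.

(** The tail given up is vertex [i]. The flag now refers to vertex [i.+1], which the closed edge
    does not touch, so it is live as soon as it was reached, that is, when [b] holds. *)
Lemma sweep_state_right_closed m i b s acc O C :
  sweep_state m i.+1 true (b :: s) acc O C ->
  sweep_state m i.+2 b s (rcons acc false) O (right_edge m i :: C).
Proof.
move=> [here /(_ isT)[_ prev] next accl sz far]; split => //.
- move=> j sj; apply: live_closed; first by rewrite addSnnS; exact: here.
    by apply: neq_index; lia.
  by apply: neq_level; lia.
- move=> bT; split => //; apply: live_closed.
  + by have := here 0 bT; rewrite addn0.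
  + by apply: neq_index => /=; lia.
  + by apply: neq_level; lia.
- move=> j ij; apply: touched_consW; first by apply: next; exact: ltnW.
    by apply: neq_level; lia.
  by apply: neq_index; lia.
- move=> j /nth_rcons_false[accj|[]] //.
  have ji : (j < i.+1)%N.
    by rewrite -sz; case: ltnP accj => // /(nth_default false) ->.
  apply: live_closed; first exact: accl.
    by apply: neq_level; lia.
  by apply: neq_index; lia.
- by rewrite size_rcons sz.
- move=> k j mk; apply: touched_consW; first exact: far.
    by apply: neq_level; lia.
  by apply: neq_level; lia.
Qed.

(** Induction on the unexplored part of the level, with one call of [explore_edge] per test. Its
    condition that success is worth more than failure comes from the monotonicity of [h] and
    [sweep_le]. *)
Lemma sweep_le_bond (h : seq bool -> R) m : seq_mono h ->
  (forall s O C, level_state m.+1 s O C ->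
     pr P (history O C) * h s <= pr P (history O C `&` reaches_level)) ->
  forall s i c acc O C, sweep_state m i c s acc O C ->
  pr P (history O C) * sweep p c s (fun t => h (acc ++ t))
    <= pr P (history O C `&` reaches_level).
Proof.
move=> hm IHm.
have hcat acc : seq_mono (fun t => h (acc ++ t)).
  move=> s t st; apply: hm; elim: acc => //= b acc.
  by rewrite /seq_le /= implybb.
have hstep acc b : (fun t => h (acc ++ t)) \o cons b =
    (fun t => h (rcons acc b ++ t)).
  by apply/funext => t /=; rewrite cat_rcons.
elim=> [|b s IH] i c acc O C /=.
  case: c => /=.
    (* The flag [true] presupposes a previous vertex, so [i] is positive. *)
    case: i => [|i] st; first by case: (sweep_prev st).
    have st' := sweep_state_nil st.
    apply: (@explore_edge (right_edge m i)).
    - by case: (sweep_prev st).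
    - exact: (sweep_next st).
    - exact: (seq_mono_cons_le [::] (hcat acc)).
    - rewrite cats1; apply: IHm; apply: sweep_state_level.
      exact: sweep_state_right_open st'.
    - rewrite cats1; apply: IHm; apply: sweep_state_level.
      exact: sweep_state_right_closed st'.
  move=> st; rewrite cats1; apply: IHm; apply: sweep_state_level.
  exact: sweep_state_skip (sweep_state_nil st).
rewrite !hstep; case: c.
  case: i => [|i] st; first by case: (sweep_prev st).
  apply: (@explore_edge (right_edge m i)).
  - by case: (sweep_prev st).
  - exact: (sweep_next st).
  - rewrite -!hstep; have m' a := seq_mono_cons a (hcat acc).
    apply: (sweep_le p01 (m' _) (m' _)) => [t||].
    + exact: (seq_mono_cons_le t (hcat acc)).
    + exact: implybb.
    + exact: seq_le_refl.
  - exact: IH (sweep_state_right_open st).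
  - exact: IH (sweep_state_right_closed st).
case: b => st; last exact: IH (sweep_state_skip st).
apply: (@explore_edge (left_edge m i)).
- by have := sweep_here st (j := 0) isT; rewrite addn0.
- exact: (sweep_next st).
- rewrite -!hstep; have m' a := seq_mono_cons a (hcat acc).
  apply: (sweep_le p01 (m' _) (m' _)) => [t|//|].
    exact: (seq_mono_cons_le t (hcat acc)).
  exact: seq_le_refl.
- exact: IH (sweep_state_left_open st).
- exact: IH (sweep_state_left_closed st).
Qed.

(** Induction on the number of levels left. At level [n], one live vertex places the whole history
    inside [reaches_level]. *)
Lemma level_le_bond k m s O C : (m + k)%N = n -> level_state m s O C ->
  pr P (history O C) * bond_value p k s <= pr P (history O C `&` reaches_level).
Proof.
elim: k m s O C => [|k IH] m s O C /=.
  rewrite addn0 => mn [sl _].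
  have mH := measurable_history O C.
  have mHG := measurableI _ _ mH measurable_reaches_level.
  have [sT|_] := boolP (has id s); last by rewrite mulr0 pr_ge0.
  rewrite mulr1; apply: pr_le => // w Hw; split => //.
  exists (find id s); rewrite -mn.
  by have [+ _] := sl (find id s) (nth_find false sT); apply.
move=> mk st.
apply: (@sweep_le_bond _ m (bond_value_mono p01 k) _ s 0 false [::]).
  by move=> s' O' C'; apply: IH; rewrite addSnnS.
exact: level_sweep_state.
Qed.

Lemma bond_value_le_reaches : bond_value p n [:: true] <= pr P reaches_level.
Proof.
have := @level_le_bond n 0 [:: true] [::] [::] (add0n n).
have -> : history [::] [::] = setT :> set (config edge).
  by apply/seteqP; split.
rewrite pr_setT mul1r setTI; apply; split; last by move=> k j _ [].
move=> [|j] /=; last by rewrite nth_nil.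
move=> _; split; last by case.
by move=> w _; exists [::] => //=; rewrite lattice_point0.
Qed.

End bond_exploration.

(** * Bernoulli site percolation *)

Section bernoulli.
Context (R : realType) (G : digraph) (Q : probability (config G) R) (q : R).
Context (Qq : bernoulli_site q Q).
Implicit Types (O C : seq G).

Definition site_history O C : set (config G) :=
  [set w | all (fun v => w v) O && all (fun v => ~~ w v) C].

Lemma measurable_site_history O C : measurable (site_history O C).
Proof.
rewrite [X in measurable X](_ : _ =
  [set w : config G | all (fun v => w v) O] `&`
  [set w : config G | all (fun v => ~~ w v) C]).
  apply: measurableI; apply: measurable_all => v _.
    exact: measurable_coordinate.
  apply: measurable_neg; exact: measurable_coordinate.
by apply/seteqP; split => [w /andP[]|w [? ?]] //; apply/andP.
Qed.

Lemma site_history_open O C v :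
  site_history (v :: O) C = site_history O C `&` [set w | w v].
Proof.
apply/seteqP; split => w /=; rewrite /site_history /=.
  by move=> /andP[/andP[-> ->] ->].
by move=> [/andP[-> ->] ->].
Qed.

Lemma site_history_closed O C v :
  site_history O (v :: C) = site_history O C `&` ~` [set w | w v].
Proof.
apply/seteqP; split => w /=; rewrite /site_history /=.
  by move=> /andP[-> /andP[/negP ? ->]].
by move=> [/andP[-> ->]] /negP ->.
Qed.

Lemma pr_site_history O C : uniq (O ++ C) ->
  pr Q (site_history O C) = q ^+ size O * (1 - q) ^+ size C.
Proof.
move=> uOC; have /and3P[_ /hasPn OC _] := etrans (esym (cat_uniq O C)) uOC.
have disj v : v \in C -> v \notin O by move=> /OC.
(* Since [O] and [C] are disjoint, membership in [O] is a pattern that prescribes both the open and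
   the closed vertices. *)
have -> : site_history O C =
    [set w : config G | forall v, v \in O ++ C -> w v = (v \in O)].
  apply/seteqP; split => w /=.
    move=> /andP[/allP wO /allP wC] v; rewrite mem_cat => /orP[vO|vC].
      by rewrite vO; exact: wO.
    by rewrite (negbTE (disj _ vC)); apply/negbTE/wC.
  move=> wOC; apply/andP; split; apply/allP => v vin.
    by rewrite wOC ?vin // mem_cat vin.
  by rewrite wOC ?(negbTE (disj _ vin)) // mem_cat vin orbT.
rewrite /pr (Qq _ uOC) /= big_cat /=; congr (_ * _).
  rewrite big_seq (eq_bigr (fun=> q)) => [|v -> //].
  by rewrite -big_seq big_const_seq count_predT -Monoid.iteropE.
rewrite big_seq (eq_bigr (fun=> 1 - q)) => [|v /disj /negbTE -> //].
by rewrite -big_seq big_const_seq count_predT -Monoid.iteropE.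
Qed.

Lemma pr_site_history_open O C v : uniq (v :: O ++ C) ->
  pr Q (site_history (v :: O) C) = q * pr Q (site_history O C).
Proof.
move=> vOC; rewrite !pr_site_history //; last by case/andP: vOC.
by rewrite /= exprS mulrA.
Qed.

Lemma pr_site_history_closed O C v : uniq (v :: O ++ C) ->
  pr Q (site_history O (v :: C)) = (1 - q) * pr Q (site_history O C).
Proof.
move=> vOC; rewrite !pr_site_history //.
- by rewrite /= exprS mulrCA.
- by case/andP: vOC.
- by rewrite -cat1s uniq_catCA.
Qed.

End bernoulli.

Lemma nth_children c t j : nth false (children c t) j =
  nth false t j || (if j is j'.+1 then nth false t j' else c).
Proof.
elim: t c j => [|b t IH] c [|j] //=.
- by rewrite orbC.
- by rewrite IH; case: j.
Qed.

Section site_exploration.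
Context (R : realType) (Q : probability (config directed_Z2) R) (q : R).
Context (Qq : bernoulli_site q Q) (x : directed_Z2).
Local Notation V := (lattice_point x).
Implicit Types (O C : seq directed_Z2) (s acc : seq bool).

Definition site_reaches_level n : set (config directed_Z2) :=
  [set w | exists j, site_reachable w x (V n j)].

Lemma measurable_site_reaches_level n : measurable (site_reaches_level n).
Proof. by apply: measurable_exists => j; exact: measurable_site_reachable. Qed.

Lemma site_reachable_open (G : digraph) (w : config G) (u v : G) :
  site_reachable w u v -> w v.
Proof. by move=> [s [_ /allP ws <-]]; apply: ws; exact: mem_last. Qed.

Lemma site_reachable_parent w m j : site_reachable w x (V m.+1 j) ->
  exists2 i, site_reachable w x (V m i) & j = i \/ j = i.+1.
Proof.
move=> [s [ps ws ls]]; have ps' : path Z2_arc (V 0 0) s.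
  by rewrite lattice_point0.
have [j' + _] := path_lattice_point (fun _ _ => id) ps'.
rewrite add0n lattice_point0 ls => /lattice_point_inj[+ _].
(* Counting levels, the path has [m.+1] steps, so there is a last one to remove. *)
case/lastP: s ps ws ls {ps'} => // s y; rewrite size_rcons => + + + [ms].
rewrite last_rcons rcons_path => /andP[ps sy] ws yV.
have ps' : path Z2_arc (V 0 0) s by rewrite lattice_point0.
have [i + _] := path_lattice_point (fun _ _ => id) ps'.
rewrite add0n lattice_point0 -ms => si; exists i.
  exists s; split => //; move: ws; rewrite -rcons_cons all_rcons => /andP[//].
move: sy; rewrite si yV => /arc_lattice_point[] /lattice_point_inj[_ ->];
  by [left|right].
Qed.

(* [acc] is the revealed part of level [m], [a] the rest of the vertices of
   that level having an open parent. *)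
Record site_state m acc a O C : Prop := SiteState {
  site_uniq : uniq (O ++ C);
  site_past : forall u, u \in O ++ C ->
    exists k j, u = V k j /\ ((k < m)%N \/ k = m /\ (j < size acc)%N);
  site_cover : forall w j, site_history O C w -> site_reachable w x (V m j) ->
    nth false (acc ++ a) j }.

Lemma site_state_fresh m acc a O C : site_state m acc a O C ->
  uniq (V m (size acc) :: O ++ C).
Proof.
move=> [u past _]; rewrite /= u andbT; apply/negP => /past[k [j]].
by move=> [/lattice_point_inj[<- <-]]; rewrite !ltnn => -[|[]].
Qed.

Lemma site_state_open m acc s O C : site_state m acc (true :: s) O C ->
  site_state m (rcons acc true) s (V m (size acc) :: O) C.
Proof.
move=> st; split; first exact: (site_state_fresh st).
  move=> u; rewrite inE => /orP[/eqP ->|/(site_past st)[k [j [-> kj]]]].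
    by exists m, (size acc); rewrite size_rcons; split => //; right.
  exists k, j; rewrite size_rcons; split => //; case: kj; [by left|].
  by move=> [-> jacc]; right; split => //; exact: leqW.
move=> w j; rewrite cat_rcons site_history_open => -[Hw _].
exact: (site_cover st).
Qed.

Lemma site_state_closed m acc s O C : site_state m acc (true :: s) O C ->
  site_state m (rcons acc false) s O (V m (size acc) :: C).
Proof.
move=> st; split.
- by have := site_state_fresh st; rewrite -cat1s uniq_catCA.
- move=> u; rewrite mem_cat inE orbCA -mem_cat.
  move=> /orP[/eqP ->|/(site_past st)[k [j [-> kj]]]].
    by exists m, (size acc); rewrite size_rcons; split => //; right.
  exists k, j; rewrite size_rcons; split => //; case: kj; [by left|].
  by move=> [-> jacc]; right; split => //; exact: leqW.
move=> w j; rewrite cat_rcons site_history_closed => -[Hw wV] wj.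
have := site_cover st Hw wj; rewrite !nth_cat; case: ltnP => // jacc.
(* The only entry that changes is that of the vertex just found closed, and a closed vertex is not
   reachable. *)
have [jacc'|] := eqVneq j (size acc).
  by exfalso; apply: wV; move: wj; rewrite jacc'; exact: site_reachable_open.
by move=> /eqP jne; have -> : (j - size acc = (j - size acc).-1.+1)%N by lia.
Qed.

Lemma site_state_skip m acc s O C : site_state m acc (false :: s) O C ->
  site_state m (rcons acc false) s O C.
Proof.
move=> st; split; first exact: (site_uniq st).
  move=> u /(site_past st)[k [j [-> kj]]].
  exists k, j; rewrite size_rcons; split => //; case: kj; [by left|].
  by move=> [-> jacc]; right; split => //; exact: leqW.
by move=> w j; rewrite cat_rcons; exact: (site_cover st).
Qed.

Lemma site_state_level m t O C : site_state m t [::] O C ->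
  site_state m.+1 [::] (children false t) O C.
Proof.
move=> st; split; first exact: (site_uniq st).
  move=> u /(site_past st)[k [j [-> kj]]]; exists k, j; split => //; left.
  by case: kj => [/ltnW|[->]].
move=> w j Hw /site_reachable_parent[i /(site_cover st Hw)].
by rewrite cats0 nth_children => it [] ->; rewrite it ?orbT.
Qed.

Section sweep.
Context (n m : nat) (h : seq bool -> R).
Context (complete : forall t O C, site_state m t [::] O C ->
  pr Q (site_history O C `&` site_reaches_level n)
    <= pr Q (site_history O C) * h t).

(** The vertices with an open parent are revealed one by one. Each is fresh, hence open with
    conditional probability [q], and splitting on its state reproduces the recursion of [thin]. *)
Lemma site_le_thin a acc O C : site_state m acc a O C ->
  pr Q (site_history O C `&` site_reaches_level n)
    <= pr Q (site_history O C) * thin q a (fun t => h (acc ++ t)).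
Proof.
have hstep acc' b : (fun t => h (acc' ++ t)) \o cons b =
    (fun t => h (rcons acc' b ++ t)).
  by apply/funext => t /=; rewrite cat_rcons.
elim: a acc O C => [|b a IH] acc O C st /=.
  by rewrite cats0; exact: complete.
rewrite !hstep; case: b st => st; last exact: IH (site_state_skip st).
have := IH _ _ _ (site_state_open st); have := IH _ _ _ (site_state_closed st).
rewrite (pr_site_history_open Qq) ?(site_state_fresh st) //.
rewrite (pr_site_history_closed Qq) ?(site_state_fresh st) //.
have mH := measurable_site_history O C.
have mHG := measurableI _ _ mH (measurable_site_reaches_level n).
have := pr_split Q mHG (measurable_coordinate (V m (size acc))).
rewrite [_ `&` site_reaches_level _ `&` _]setIAC.
rewrite [_ `&` site_reaches_level _ `&` ~` _]setIAC.
rewrite -site_history_open -site_history_closed => -> h0 h1.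
by apply: le_trans (lerD h1 h0) _; lra.
Qed.

End sweep.

Lemma site_le_level k m n a O C : (m + k)%N = n -> site_state m [::] a O C ->
  pr Q (site_history O C `&` site_reaches_level n)
    <= pr Q (site_history O C) * site_value q k a.
Proof.
elim: k m a O C => [|k IH] m a O C mn st.
  apply: (@site_le_thin n m (fun t => (has id t)%:R) _ _ [::] _ _ st).
  move=> t O' C' st'.
  have mH := measurable_site_history O' C'.
  have mHG := measurableI _ _ mH (measurable_site_reaches_level n).
  have [tT|tF] := boolP (has id t); first by rewrite mulr1 pr_le.
  (* When no entry is left, [site_cover] excludes every vertex of level [n]. *)
  rewrite mulr0 [X in pr Q X](_ : _ = set0) ?pr_set0 //.
  apply/seteqP; split => // w [Hw [j]].
  rewrite -mn addn0 => /(site_cover st' Hw); rewrite cats0 => tj.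
  move/hasPn : tF => /(_ (nth false t j)); rewrite tj => /(_ _)/negP.
  apply=> //.
  rewrite -[X in X \in _]tj mem_nth //; case: ltnP => // /(nth_default false).
  by rewrite tj.
apply: (@site_le_thin n m (fun t => site_value q k (children false t))
  _ _ [::] _ _ st) => t O' C' st'.
apply: (IH m.+1); first by rewrite addSnnS.
exact: site_state_level.
Qed.

Lemma site_reaches_le_site_value n :
  pr Q (site_reaches_level n) <= site_value q n [:: true].
Proof.
have := @site_le_level n 0 n [:: true] [::] [::] (add0n n).
have -> : site_history [::] [::] = setT :> set (config directed_Z2).
  by apply/seteqP; split.
(* The initial cover holds because a path ending at level 0 is empty, so that [j] is 0. *)
rewrite pr_setT mul1r setTI; apply; split => // w j _ [s [ps _ ls]].
have ps' : path Z2_arc (V 0 0) s by rewrite lattice_point0.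
have [j' + ji] := path_lattice_point (fun _ _ => id) ps'.
rewrite lattice_point0 ls => /lattice_point_inj[s0 jj]; move: ji.
by rewrite -jj -s0; case: j {ls jj} => // j; lia.
Qed.

End site_exploration.

(** * Percolation and the events of reaching every level *)

Lemma probability_exists_null d (T : measurableType d) (R : realType)
    (P : probability T R) (J : countType) (F : J -> set T) :
  (forall j, measurable (F j)) -> (forall j, P (F j) = 0%E) ->
  P [set w | exists j, F j w] = 0%E.
Proof.
move=> mF F0; apply: measure_negligible; first exact: measurable_exists.
pose F' k := if unpickle k is Some j then F j else set0.
apply: (@negligibleS _ _ _ _ (\bigcup_k F' k)).
  by move=> w [j Fw]; exists (pickle j) => //; rewrite /F' pickleK.
apply: negligible_bigcup => k; rewrite /F'; case: unpickle => [j|].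
  by apply/negligibleP; [exact: mF|exact: F0].
exact: negligible_set0.
Qed.

Lemma path_from_lattice_point x r s : subrel r Z2_arc ->
  path r (x : directed_Z2) s ->
  exists2 j, last x s = lattice_point x (size s) j & (j <= size s)%N.
Proof.
move=> rZ ps; have ps' : path r (lattice_point x 0 0) s.
  by rewrite lattice_point0.
have [j + jb] := path_lattice_point rZ ps'.
by rewrite lattice_point0 => ->; exists j => //; case/andP: jb.
Qed.

Lemma open_arc_sub (G : digraph) (w : config (edge G)) :
  subrel (open_arc w) (@Defs.arc G).
Proof. by move=> u v; rewrite /open_arc; case: insubP. Qed.

(** An open path with at least [n] steps passes through level [n]. If that level is not reached, all
    open paths are shorter and the cluster lies in a finite triangle. *)
Lemma infinite_site_reaches x (w : config directed_Z2) n :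
  infinite_set (site_reachable w x) -> site_reaches_level x n w.
Proof.
move=> winf; apply: contrapT => wn; apply: winf.
apply: (@sub_finite_set _ _ [set lattice_point x k j | k in `I_n & j in `I_n]).
  move=> y [s [ps ws ls]].
  have [j sj js] := path_from_lattice_point (fun _ _ => id) ps.
  have [sn|ns] := ltnP (size s) n.
    exists (size s) => //; exists j => /=; last by rewrite -sj.
    exact: leq_ltn_trans sn.
  exfalso; apply: wn.
  have ps' := take_path n ps.
  have [i si _] := path_from_lattice_point (fun _ _ => id) ps'.
  exists i, (take n s); split => //.
    move: ws => /= /andP[-> /allP ws]; apply/allP => v /mem_take; exact: ws.
  by rewrite si size_takel.
exact: finite_image2.
Qed.

Lemma bond_reaches_nonincreasing x :
  nonincreasing_seq (reaches_level x).
Proof.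
move=> m n mn; apply/subsetPset => w [j [s ps ls]].
have ps' := take_path m ps.
have [k sk _] := path_from_lattice_point (open_arc_sub (w := w)) ps.
have [i si _] := path_from_lattice_point (open_arc_sub (w := w)) ps'.
have [ns _] : n = size s /\ j = k.
  by apply: (@lattice_point_inj x); rewrite -sk -ls.
by exists i, (take m s) => //; rewrite si size_takel // -ns.
Qed.

(** The level takes every natural value on the cluster. *)
Lemma bond_reaches_infinite x (w : config (edge directed_Z2)) :
  (forall n, reaches_level x n w) -> infinite_set (bond_reachable w x).
Proof.
move=> wn wfin; apply: infinite_nat.
pose level (y : int * int) := absz (y.1 + y.2 - (x.1 + x.2))%R.
apply: (@sub_finite_set _ _ (level @` bond_reachable w x)); last first.
  exact: finite_image.
move=> n _; have [j wj] := wn n; exists (lattice_point x n j) => //.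
by rewrite /level /lattice_point /=; lia.
Qed.

(** For a fixed [x], the site cluster is infinite with [Q]-probability at most [site_value (p * p) n
    [:: true]], hence at most [bond_value p n [:: true]], hence at most the [P]-probability of
    reaching level [n]. The latter tends to the [P]-probability of reaching all levels, which is
    0. *)
Lemma site_percolation_null (R : realType) (p : R)
    (P : probability (config (edge directed_Z2)) R)
    (Q : probability (config directed_Z2) R) : 0 <= p <= 1 -> Pa p P ->
  ~ bond_percolates P -> bernoulli_site (p * p) Q ->
  Q (@site_percolation_event directed_Z2) = 0%E.
Proof.
move=> p01 Pp nperc Qp; apply: probability_exists_null => x.
  by apply: measurable_infinite => y; exact: measurable_site_reachable.
have mx : measurable
    [set w : config directed_Z2 | infinite_set (site_reachable w x)].
  by apply: measurable_infinite => y; exact: measurable_site_reachable.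
have mB n : measurable (reaches_level x n) := measurable_reaches_level x n.
have mI : measurable (\bigcap_n reaches_level x n) by exact: bigcapT_measurable.
have P0 : P (\bigcap_n reaches_level x n) = 0%E.
  have P0 : P (@bond_percolation_event directed_Z2) = 0%E.
    apply/eqP; rewrite -measure_le0 leNgt; exact/negP.
  apply/eqP; rewrite -measure_le0 -P0; apply: le_measure; rewrite ?inE //.
    exact: measurable_bond_percolation_event.
  by move=> w wI; exists x; apply: bond_reaches_infinite => n; exact: wI.
apply/eqP; rewrite -measure_le0 -P0.
have Pcvg : P \o reaches_level x @ \oo --> P (\bigcap_n reaches_level x n).
  apply: nonincreasing_cvg_mu => //; last exact: bond_reaches_nonincreasing.
  exact: (le_lt_trans (probability_le1 P (mB 0)) (ltry _)).
rewrite -(cvg_lim _ Pcvg) //; apply: lime_ge.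
  by apply/cvg_ex; exists 0%E; rewrite -P0.
apply: nearW => n /=; rewrite !prE // lee_fin.
apply: (le_trans (pr_le _ _ _ (fun w => @infinite_site_reaches x w n))) => //.
  exact: measurable_site_reaches_level.
apply: (le_trans (site_reaches_le_site_value Qp x n)).
apply: (le_trans (site_value_le_bond_value p01 n _)).
exact: bond_value_le_reaches.
Qed.

(** * Existence of the Bernoulli measures *)

Lemma probability_restriction d (T : measurableType d) (R : realType)
    (mu : {measure set T -> \bar R}) (D : set T) :
  measurable D -> mu D = 1%E ->
  exists P : probability T R, forall U, P U = mu (U `&` D).
Proof.
(* The Dirac mass is the fallback of [mnormalize] for total mass 0 or infinity, which [m1]
   excludes. *)
move=> mD mu1; exists (mnormalize (mrestr mu mD) (dirac point)) => U.
have m1 : mrestr mu mD setT = 1%E by rewrite /mrestr setTI.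
transitivity ((mrestr mu mD U) * ((fine (1%E : \bar R))^-1)%:E)%E; last first.
  by rewrite /= invr1 mule1.
rewrite /= /mnormalize; case: ifPn => [/orP[]/eqP e|_].
- by have := etrans (esym m1) e => /eqP; rewrite eqe oner_eq0.
- by have := etrans (esym m1) e.
by rewrite -[RHS]/(mrestr mu mD U * (fine 1)^-1%:E)%E -m1.
Qed.

(* Digits of [x] in the expansion that splits [`[l, l + d[] in the ratio
   [q : 1 - q]; the digit is [true] on the left part. *)
Fixpoint digit (R : realType) (q l d x : R) (n : nat) : bool :=
  if n is n'.+1 then
    if x < l + q * d then digit q l (q * d) x n'
    else digit q (l + q * d) ((1 - q) * d) x n'
  else x < l + q * d.

Section digits.
Context (R : realType) (q : R) (q01 : 0 <= q <= 1).
Local Notation mu := (@lebesgue_measure R).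

Lemma measurable_digit l d n :
  measurable_fun [set: measurableTypeR R] (fun x => digit q l d x n).
Proof.
elim: n l d => [|n IH] l d /=; first exact: measurable_fun_ltr.
by apply: measurable_fun_ifT => //; exact: measurable_fun_ltr.
Qed.

(** [None] leaves a digit free. A condition on finitely many scattered digits thus becomes one on an
    initial segment, open to induction. *)
Definition agrees (o : option bool) (b : bool) :=
  if o is Some b' then b == b' else true.

Definition weight (o : option bool) : R :=
  if o is Some b then (if b then q else 1 - q) else 1.

Definition digit_cylinder (l d : R) (n : nat) (c : nat -> option bool) :
    set R :=
  [set x | l <= x < l + d /\
           forall k, (k < n)%N -> agrees (c k) (digit q l d x k)].

Lemma measurable_digit_cylinder l d n c :
  measurable (digit_cylinder l d n c : set (measurableTypeR R)).
Proof.
rewrite [X in measurable X](_ : _ = `[l, l + d[%classic `&` \bigcap_k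
    [set x | (k < n)%N -> agrees (c k) (digit q l d x k)]).
  apply: measurableI => //; apply: bigcapT_measurable => k.
  rewrite [X in measurable X](_ : _ = [set: R] `&`
      (fun x => digit q l d x k) @^-1` [set b | (k < n)%N -> agrees (c k) b]).
    exact: measurable_digit.
  by rewrite setTI.
apply/seteqP; split => x /=; rewrite in_itv /=.
  by move=> [lx kx]; split => // k _; exact: kx.
by move=> [lx kx]; split => // k; exact: kx.
Qed.

(** Self-similarity: once the first digit is known, the others are the digits relative to the
    subinterval it selects. *)
Lemma digit_cylinderS l d n c : 0 <= d ->
  digit_cylinder l d n.+1 c =
  (if agrees (c 0) true then digit_cylinder l (q * d) n (c \o S) else set0) `|`
  (if agrees (c 0) false then
     digit_cylinder (l + q * d) ((1 - q) * d) n (c \o S) else set0).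
Proof.
move=> d0; have /andP[q0 q1] := q01.
have qd : 0 <= q * d by rewrite mulr_ge0.
have qd' : 0 <= (1 - q) * d by rewrite mulr_ge0 ?subr_ge0.
have e : l + q * d + (1 - q) * d = l + d by ring.
apply/seteqP; split => x /=.
  move=> [/andP[lx xd] kx]; have [xq|xq] := ltP x (l + q * d).
    left; have := kx 0 isT; rewrite /= xq => -> /=; split; first by rewrite lx.
    by move=> k kn; have := kx k.+1 kn; rewrite /= xq.
  right; have := kx 0 isT; rewrite /= ltNge xq /= => -> /=.
  split; first by rewrite xq e.
  by move=> k kn; have := kx k.+1 kn; rewrite /= ltNge xq.
case; case: ifP => // c0 [/andP[lx xd] kx].
  split; first by rewrite lx (lt_le_trans xd) //; lra.
  by case=> [_|k kn] /=; rewrite xd //; exact: kx.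
split; first by rewrite -e xd andbT; lra.
by case=> [_|k kn] /=; rewrite ltNge lx //=; exact: kx.
Qed.

Lemma lebesgue_digit_cylinder l d n c : 0 <= d ->
  mu (digit_cylinder l d n c) = (d * \prod_(k < n) weight (c k))%:E.
Proof.
elim: n l d c => [|n IH] l d c d0.
  rewrite big_ord0 mulr1 (_ : digit_cylinder _ _ _ _ = `[l, l + d[%classic).
    rewrite lebesgue_measure_itv /= lte_fin; case: ltP => [_|dl].
      by rewrite -EFinB addrC addKr.
    by have -> : d = 0 by lra.
  apply/seteqP; split => x /=; rewrite in_itv /=; first by case.
  by move=> lx; split.
have /andP[q0 q1] := q01; rewrite digit_cylinderS // measureU.
- rewrite big_ord_recl /=.
  have -> (A : set R) b : mu (if b then A else set0) = if b then mu A else 0%E.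
    by case: b => //; rewrite measure0.
  have -> (A : set R) b : mu (if b then A else set0) = if b then mu A else 0%E.
    by case: b => //; rewrite measure0.
  rewrite !IH ?mulr_ge0 ?subr_ge0 // /weight.
  set pi := \prod_(i < n) _; rewrite -/weight.
  by case: (c 0) => [[]|] /=; rewrite ?adde0 ?add0e -?EFinD; congr EFin;
    rewrite /pi; ring.
- by case: ifP => // _; exact: measurable_digit_cylinder.
- by case: ifP => // _; exact: measurable_digit_cylinder.
apply/seteqP; split => // x [] /=; case: ifP => // _ [/andP[_ xq] _].
by case: ifP => // _ [/andP[]]; rewrite leNgt xq.
Qed.

End digits.

Lemma measurable_fun_coordinates d (T : measurableType d) (I : Type) (F : set I)
    (f : T -> g_sigma_algebraType (coordinate_events F)) :
  (forall i, F i -> measurable [set t | f t i]) -> measurable_fun setT f.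
Proof.
move=> mf; apply: (@measurability _ _ T
  (g_sigma_algebraType (coordinate_events F)) setT f (coordinate_events F)).
  by [].
by move=> _ [_ [i Fi <-] <-]; rewrite setTI; exact: mf.
Qed.

Lemma measurable_fun_config d (T : measurableType d) (I : Type)
    (f : T -> config I) : (forall i, measurable [set t | f t i]) ->
  measurable_fun setT f.
Proof. by move=> mf; apply: measurable_fun_coordinates => i _; exact: mf. Qed.

(** A vertex [v] reads the digit of index [pickle v] of a uniform point of the unit interval. The
    law of the resulting configuration is the product measure. *)
Lemma bernoulli_site_exists (R : realType) (G : digraph) (q : R) :
  0 <= q <= 1 -> exists Q : probability (config G) R, bernoulli_site q Q.
Proof.
move=> q01; have mu1 : lebesgue_measure (`[0, 1[%classic : set R) = 1%E.
  by rewrite lebesgue_measure_itv /= lte_fin ltr01 oppr0 adde0.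
have [|P PE] := @probability_restriction _ (measurableTypeR R) R
    (@lebesgue_measure R) `[0, 1[%classic _ mu1; first by [].
pose f (x : measurableTypeR R) : config G := fun v => digit q 0 1 x (pickle v).
have mf : measurable_fun setT f.
  apply: measurable_fun_config => v; rewrite (_ : [set t | _] =
      setT `&` (fun x => digit q 0 1 x (pickle v)) @^-1` [set true]).
    exact: measurable_digit.
  by rewrite setTI.
pose F : {mfun measurableTypeR R >-> config G} :=
  HB.pack f (isMeasurableFun.Build _ _ _ _ f mf).
exists (distribution P F) => s a us; rewrite /= /distribution /pushforward /= PE.
pose n := (\max_(v <- s) pickle v).+1.
have sn v : v \in s -> (pickle v < n)%N.
  by move=> vs; rewrite /n ltnS (big_rem v) //= leq_maxl.
(* [pickle_inv], unlike [unpickle], only decodes actual codes, so each vertex of [s] constrains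
   exactly one digit. *)
pose c k := if pickle_inv k is Some v then
              (if (v : G) \in s then Some (a v) else None) else None.
have cp v : c (pickle v) = if v \in s then Some (a v) else None.
  by rewrite /c pickleK_inv.
rewrite (_ : _ `&` _ = digit_cylinder q 0 1 n c).
  apply: etrans (lebesgue_digit_cylinder q01 0 n c ler01) _.
  rewrite mul1r; congr EFin.
  rewrite -(big_mkord xpredT (fun k => weight q (c k))).
  (* Indices that are not codes of vertices of [s] have weight 1. *)
  rewrite (bigID (mem (map pickle s))) /= [X in _ * X]big1 ?mulr1.
    rewrite -big_filter (perm_big (map pickle s)).
      rewrite big_map; apply: eq_big_seq => v vs.
      by rewrite cp vs.
    apply: uniq_perm; first by rewrite filter_uniq // iota_uniq.
      by rewrite map_inj_uniq //; exact: (pcan_inj pickleK).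
    move=> k; rewrite mem_filter mem_index_iota /=.
    by case: mapP => // -[v /sn vn ->].
  move=> k ks; rewrite /c; case E: pickle_inv => [v|] //; case: ifP => // vs.
  case/negP: ks; apply/mapP; exists v => //.
  by have := @pickle_invK G k; rewrite E.
apply/seteqP; split => x; rewrite /digit_cylinder /= in_itv /= add0r.
  move=> [xs x01]; split => // k _; rewrite /c.
  case E: pickle_inv => [v|] //; case: ifP => // vs /=; apply/eqP.
  by rewrite -(xs _ vs) /f; have := @pickle_invK G k; rewrite E => /= ->.
move=> [x01 kx]; split => // v vs; have := kx _ (sn _ vs).
by rewrite cp vs => /eqP.
Qed.

(** * Independence and Harris' inequality *)

(** The finite measures [P (A]&[B)] and [P A * P B] in the variable [A] agree on a pi-system, hence
    on the sigma-algebra it generates. *)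
Lemma independent_generated d (T : measurableType d) (R : realType)
    (P : probability T R) (G : set (set T)) (B : set T) :
  measurable B -> G `<=` measurable -> setI_closed G -> G setT ->
  (forall A, G A -> P (A `&` B) = (P A * P B)%E) ->
  forall A, <<s G >> A -> P (A `&` B) = (P A * P B)%E.
Proof.
move=> mB mG GI GT indep A sA.
have b0 : 0 <= fine (P B) by rewrite fine_ge0.
have PB : P B = ((NngNum b0)%:num)%:E by rewrite /= fineK // fin_num_measure.
transitivity (mscale (NngNum b0) P A); last by rewrite /mscale muleC -PB.
apply: (@g_sigma_algebra_measure_unique _ _ _ G mG (fun=> setT) (fun=> GT) _
  (mrestr P mB) (mscale (NngNum b0) P)) => //.
- by rewrite bigcup_const.
- move=> C GC; transitivity (P (C `&` B)); first by [].
  by rewrite indep // muleC [X in (X * _)%E]PB.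
move=> k; have mTB := measurableI _ _ measurableT mB.
exact: (le_lt_trans (probability_le1 P mTB) (ltry _)).
Qed.

Section bernoulli_coordinates.
Context (R : realType) (G : digraph) (Q : probability (config G) R) (q : R).
Context (Qq : bernoulli_site q Q).

(** Unlike the single coordinates, these cylinders are stable under intersection, as
    [independent_generated] requires. *)
Definition all_open (F : set G) : set (set (config G)) :=
  [set [set w : config G | all (fun v => w v) O]
     | O in [set O : seq G | [set` O] `<=` F]].

Lemma all_open_setI_closed F : setI_closed (all_open F).
Proof.
move=> _ _ [L1 F1 <-] [L2 F2 <-]; exists (L1 ++ L2).
  by move=> v /=; rewrite mem_cat => /orP[/F1|/F2].
apply/seteqP; split => w /=; rewrite all_cat; first by move=> /andP[].
by move=> [-> ->].
Qed.

Lemma all_openT F : all_open F setT.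
Proof. by exists [::] => //; apply/seteqP; split. Qed.

Lemma all_open_measurable F : all_open F `<=` measurable.
Proof.
move=> _ [L _ <-]; apply: measurable_all => v _; exact: measurable_coordinate.
Qed.

Lemma coordinate_all_open F :
  <<s coordinate_events F >> `<=` <<s all_open F >>.
Proof.
apply: sub_sigma_algebra2 => _ [v Fv <-]; exists [:: v].
  by move=> u /=; rewrite inE => /eqP ->.
by apply/seteqP; split => w /=; rewrite andbT.
Qed.

Lemma probability_all_open O :
  Q [set w : config G | all (fun v => w v) O] = (q ^+ size (undup O))%:E.
Proof.
rewrite (_ : [set w | _] = site_history (undup O) [::]).
  rewrite prE; last exact: measurable_site_history.
  by rewrite (pr_site_history Qq) ?cats0 ?undup_uniq // mulr1.
apply/seteqP; split => w; rewrite /site_history /= andbT => /allP wO;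
  apply/allP => v vO; apply: wO; move: vO; by rewrite mem_undup.
Qed.

Lemma bernoulli_independent (F1 F2 : set G) (A1 A2 : set (config G)) :
  F1 `&` F2 = set0 -> <<s coordinate_events F1 >> A1 ->
  <<s coordinate_events F2 >> A2 -> Q (A1 `&` A2) = (Q A1 * Q A2)%E.
Proof.
move=> F12 /coordinate_all_open sA1 sA2.
apply: (independent_generated (G := all_open F1)) => //.
- exact: coordinate_sigma_algebra_measurable sA2.
- exact: all_open_measurable.
- exact: all_open_setI_closed.
- exact: all_openT.
(* With the first event now in its pi-system, the same extension is applied to the second one. *)
move=> A GA; rewrite setIC muleC.
apply: (independent_generated (G := all_open F2)) => //.
- exact: all_open_measurable GA.
- exact: all_open_measurable.
- exact: all_open_setI_closed.
- exact: all_openT.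
- move=> _ [L2 OF2 <-]; case: GA => L1 OF1 <-.
  rewrite (_ : _ `&` _ = [set w : config G | all (fun v => w v) (L2 ++ L1)]).
    rewrite !probability_all_open -EFinM -exprD -size_cat.
    rewrite undup_cat (_ : [seq x <- undup L2 | x \notin L1] = undup L2) //.
    apply/all_filterP/allP => v; rewrite mem_undup => vO2; apply/negP => vO1.
    by have : (F1 `&` F2) v by [split; [exact: OF1|exact: OF2]]; rewrite F12.
  apply/seteqP; split => w /=; rewrite all_cat; last by move=> /andP[].
  by move=> [-> ->].
exact: coordinate_all_open.
Qed.

Definition update (w : config G) (v : G) (b : bool) : config G :=
  fun u => if u == v then b else w u.

Definition slice (A : set (config G)) (v : G) (b : bool) : set (config G) :=
  [set w | A (update w v b)].

Lemma slice_sigma_algebra A v b : measurable A ->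
  <<s coordinate_events [set~ v] >> (slice A v b).
Proof.
move=> mA; pose T := g_sigma_algebraType (coordinate_events [set~ v]).
have mf : @measurable_fun _ _ T (config G) setT (fun w => update w v b).
  apply: measurable_fun_coordinates => u _.
  rewrite /update; case: eqP => uv; last by apply: sub_sigma_algebra; exists u.
  by case: b; [rewrite (_ : [set t | _] = setT)|rewrite (_ : [set t | _] = set0)];
    by [|apply/seteqP; split].
by have := mf (measurableT) _ mA; rewrite setTI.
Qed.

Lemma measurable_slice A v b : measurable A -> measurable (slice A v b).
Proof.
move=> mA; have := @slice_sigma_algebra A v b mA.
exact: coordinate_sigma_algebra_measurable.
Qed.

(** Where [v] has state [b], the event [A] coincides with its slice, and the slice is independent of
    the state of [v]. *)
Lemma pr_slices A v : measurable A ->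
  pr Q A = q * pr Q (slice A v true) + (1 - q) * pr Q (slice A v false).
Proof.
move=> mA; have mv := measurable_coordinate v.
have ms b := @measurable_slice A v b mA.
have s1 : <<s coordinate_events [set v] >> [set w : config G | w v].
  by apply: sub_sigma_algebra; exists v.
have s0 : <<s coordinate_events [set v] >> (~` [set w : config G | w v]).
  exact: (@measurableC _ (g_sigma_algebraType (coordinate_events [set v]))).
have disj : [set v] `&` [set~ v] = set0 by rewrite setICr.
have := bernoulli_independent disj s1 (@slice_sigma_algebra A v true mA).
have := bernoulli_independent disj s0 (@slice_sigma_algebra A v false mA).
rewrite !(prE Q) //; try exact: measurableI; last first.
- by apply: measurableI => //; exact: measurableC.
- exact: measurableC.
rewrite -!EFinM => -[e0] [e1].
have qv : pr Q [set w | w v] = q.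
  have := pr_site_history Qq (O := [:: v]) (C := [::]) isT.
  rewrite /= mulr1 expr1 => <-; congr pr; apply/seteqP; split => w;
    by rewrite /site_history /= !andbT.
have := pr_split Q mA mv; rewrite prC // qv in e0 e1 * => ->.
have upd (w : config G) b : w v = b -> update w v b = w.
  by move=> wv; apply/funext => u; rewrite /update; case: eqP => // ->.
rewrite -e1 -e0; congr (_ + _); congr pr; apply/seteqP; split => w /=.
- by move=> [Aw wv]; rewrite /slice /= upd.
- by move=> [wv]; rewrite /slice /= upd.
- move=> [Aw /negP/negbTE wv]; rewrite /slice /= upd //.
  by split => //; rewrite wv.
- move=> [/negP/negbTE wv]; rewrite /slice /= upd //.
  by split => //; rewrite wv.
Qed.

End bernoulli_coordinates.

(** * Approximation of events by finite-dimensional ones *)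

Section cylinder_approximation.
Context (R : realType) (G : digraph) (Q : probability (config G) R).
Implicit Types A B : set (config G).

Definition symdiff A B : set (config G) := (A `\` B) `|` (B `\` A).

Lemma measurable_symdiff A B : measurable A -> measurable B ->
  measurable (symdiff A B).
Proof. by move=> mA mB; apply: measurableU; exact: measurableD. Qed.

Definition determined_by (s : seq G) A :=
  forall w w' : config G, (forall v, v \in s -> w v = w' v) -> A w -> A w'.

Definition approximable A := forall e : R, 0 < e -> exists s B,
  [/\ measurable B, determined_by s B & pr Q (symdiff A B) < e].

Lemma approximableU A B : measurable A -> measurable B ->
  approximable A -> approximable B -> approximable (A `|` B).
Proof.
move=> mA mB aA aB e e0; have e20 : 0 < e / 2 by rewrite divr_gt0.
have [s [A' [mA' sA' AA']]] := aA _ e20.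
have [t [B' [mB' tB' BB']]] := aB _ e20.
exists (s ++ t), (A' `|` B'); split; first exact: measurableU.
  move=> w w' ww [/sA' A'w|/tB' B'w]; [left; apply: A'w|right; apply: B'w];
    by move=> v vin; apply: ww; rewrite mem_cat vin ?orbT.
have mAA := measurable_symdiff mA mA'; have mBB := measurable_symdiff mB mB'.
apply: (@le_lt_trans _ _ (pr Q (symdiff A A' `|` symdiff B B'))).
  apply: pr_le; [by apply: measurable_symdiff; exact: measurableU
                |exact: measurableU|].
  by move=> w; rewrite /symdiff /= /setD /=; tauto.
have := prUI Q mAA mBB; have := pr_ge0 Q (symdiff A A' `&` symdiff B B').
lra.
Qed.

Lemma approximable_bigU (A : nat -> set (config G)) n :
  (forall k, measurable (A k)) -> (forall k, approximable (A k)) ->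
  approximable (\big[setU/set0]_(k < n) A k).
Proof.
move=> mA aA; elim: n => [|n IH]; last first.
  rewrite big_ord_recr /=; apply: approximableU => //.
  by apply: bigsetU_measurable.
rewrite big_ord0 => e e0; exists [::], set0; split => //.
by rewrite /symdiff !setDv setU0 pr_set0.
Qed.

(** Continuity from below replaces the union by a finite one at cost [e / 2]; approximating the
    finite union costs the other half. *)
Lemma approximable_bigcup (A : nat -> set (config G)) :
  (forall k, measurable (A k)) -> (forall k, approximable (A k)) ->
  approximable (\bigcup_k A k).
Proof.
move=> mA aA e e0; have mU : measurable (\bigcup_k A k).
  exact: bigcupT_measurable.
have e20 : 0 < e / 2 by rewrite divr_gt0.
pose U n := \big[setU/set0]_(k < n) A k.
have mUn n : measurable (U n) by exact: bigsetU_measurable.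
have UA n : U n `<=` \bigcup_k A k by exact: bigsetU_bigcup.
have [n Un] : exists n, pr Q (\bigcup_k A k) - pr Q (U n) < e / 2.
  have UE : \bigcup_n U n = \bigcup_k A k.
    apply/seteqP; split => [w [n _ /UA]//|w [k _ Akw]].
    by exists k.+1 => //; rewrite /U big_ord_recr; right.
  have cvgU : Q \o U @ \oo --> Q (\bigcup_n U n).
    apply: nondecreasing_cvg_mu => //; first by rewrite UE.
    by move=> m n mn; apply/subsetPset; apply: subset_bigsetU.
  rewrite UE (prE Q) // in cvgU; move/fine_cvgP : cvgU => [_ /cvgrPdist_lt].
  move=> /(_ _ e20)[n _ /(_ n (leqnn n))] /= Un; exists n.
  by apply: le_lt_trans Un; rewrite ler_norm.
have [s [B [mB sB AB]]] := approximable_bigU n mA aA e20.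
exists s, B; split => //; have mD := measurable_symdiff (mUn n) mB.
have mUn' := measurableC (mUn n); have mAU := measurableI _ _ mU mUn'.
apply: (@le_lt_trans _ _
  (pr Q ((\bigcup_k A k `&` ~` U n) `|` symdiff (U n) B))).
  apply: pr_le; [exact: measurable_symdiff|exact: measurableU|].
  move=> w; have := UA n w; have := EM (U n w); rewrite /symdiff /= /setD /=.
  tauto.
have := prUI Q mAU mD.
have := pr_ge0 Q ((\bigcup_k A k `&` ~` U n) `&` symdiff (U n) B).
have := prD Q mU (mUn n) (UA n); move: AB; rewrite -/(U n); lra.
Qed.

Lemma approximable_measurable A : measurable A -> approximable A.
Proof.
(* The measurable approximable events form a sigma-algebra that contains the coordinate events. *)
suff : (@measurable _ (config G)) `<=` [set A | measurable A /\ approximable A].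
  by move=> h /h[].
move: A => _; apply: smallest_sub; last first.
  move=> _ [v _ <-]; split; first exact: measurable_coordinate.
  move=> e e0; exists [:: v], [set w : config G | w v]; split.
  - exact: measurable_coordinate.
  - by move=> w w' /(_ v (mem_head _ _)) /= ->.
  - by rewrite /symdiff !setDv setU0 pr_set0.
split.
- split => // e e0; exists [::], set0; split => //.
  by rewrite /symdiff !setDv setU0 pr_set0.
- move=> A [mA aA]; rewrite setTD; split; first exact: measurableC.
  move=> e /aA[s [B [mB sB AB]]]; exists s, (~` B); split.
    exact: measurableC.
    by move=> w w' ww Bw Bw'; apply: Bw; apply: (sB w') => // v vs; rewrite ww.
  rewrite (_ : symdiff _ _ = symdiff A B) //; apply/seteqP.
  split => w; have := EM (A w); have := EM (B w);
    rewrite /symdiff /= /setD /=; tauto.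
move=> A aA; have mA k : measurable (A k : set (config G)) := (aA k).1.
split; first exact: (@bigcupT_measurable _ (config G)).
by apply: approximable_bigcup => // k; exact: (aA k).2.
Qed.

End cylinder_approximation.

(** Chebyshev's inequality on two points: the mean of the products exceeds the product of the means
    by [q * (1 - q) * (a1 - a0) * (b1 - b0)]. The errors are simply averaged. *)
Lemma mix_chebyshev (R : realType) (q a1 a0 b1 b0 e1 e0 x1 x0 : R) :
  0 <= q <= 1 -> a0 <= a1 -> b0 <= b1 ->
  a1 * b1 - e1 <= x1 -> a0 * b0 - e0 <= x0 ->
  (q * a1 + (1 - q) * a0) * (q * b1 + (1 - q) * b0) - (q * e1 + (1 - q) * e0)
    <= q * x1 + (1 - q) * x0.
Proof.
move=> q01 a01 b01 h1 h0; have := le_mix q01 h1 h0; case/andP: q01 => q0 q1.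
have : 0 <= q * (1 - q) * ((a1 - a0) * (b1 - b0)).
  by rewrite !mulr_ge0 ?subr_ge0.
lra.
Qed.

Section harris.
Context (R : realType) (G : digraph) (Q : probability (config G) R) (q : R).
Context (Qq : bernoulli_site q Q) (q01 : 0 <= q <= 1).
Implicit Types A B C : set (config G).

Lemma increasing_slice A v b : increasing_event A ->
  increasing_event (slice A v b).
Proof.
move=> incA w w' ww; apply: incA => u; rewrite /update; case: eqP => // _.
exact: ww.
Qed.

Lemma slice_sub A v : increasing_event A ->
  slice A v false `<=` slice A v true.
Proof.
by move=> incA w; apply: incA => u; rewrite /update; case: eqP.
Qed.

(** Induction on the coordinates of [C], slicing all three events. Slices of [A] and [B] stay
    increasing, and the error averages over the slices exactly, so it does not accumulate. When no
    coordinate is left, [C] is empty or full and the bound is elementary. *)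
Lemma harris_approximation s A B C : measurable A -> measurable B ->
  measurable C -> increasing_event A -> increasing_event B ->
  determined_by s C ->
  pr Q A * pr Q B - pr Q (symdiff A C) <= pr Q (A `&` B).
Proof.
elim: s A B C => [|v s IH] A B C mA mB mC iA iB sC; last first.
  have s1 b A' := @measurable_slice G A' v b.
  have sC' b : determined_by s (slice C v b).
    move=> w w' ww; apply: sC => u; rewrite inE /update.
    by case: eqP => //= _; exact: ww.
  have I b := IH _ _ _ (s1 b _ mA) (s1 b _ mB) (s1 b _ mC)
    (@increasing_slice A v b iA) (@increasing_slice B v b iB) (sC' b).
  have mAB := measurableI _ _ mA mB; have mAC := measurable_symdiff mA mC.
  rewrite (pr_slices Qq v mA) (pr_slices Qq v mB).
  rewrite (pr_slices Qq v mAB) (pr_slices Qq v mAC).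
  have A01 := pr_le Q (s1 _ _ mA) (s1 _ _ mA) (@slice_sub A v iA).
  have B01 := pr_le Q (s1 _ _ mB) (s1 _ _ mB) (@slice_sub B v iB).
  exact: mix_chebyshev q01 A01 B01 (I true) (I false).
have mAB := measurableI _ _ mA mB; have mA' := measurableC mA.
have := pr_le1 Q mA; have := pr_le1 Q mB.
have := pr_ge0 Q A; have := pr_ge0 Q B.
have [[w Cw]|C0] := EM (exists w, C w).
  have -> : C = setT by apply/seteqP; split => // w' _; apply: sC Cw.
  rewrite /symdiff setDT set0U setTD prC //.
  have := pr_split Q mB mA; rewrite setIC.
  have := pr_le Q (measurableI _ _ mB mA') mA' (@subIsetr _ _ _).
  rewrite prC //; nra.
have -> : C = set0 by apply/seteqP; split => // w Cw; apply: C0; exists w.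
rewrite /symdiff set0D setU0 setD0; have := pr_ge0 Q (A `&` B); nra.
Qed.

Lemma harris A B : measurable A -> measurable B -> increasing_event A ->
  increasing_event B -> (Q A * Q B <= Q (A `&` B))%E.
Proof.
move=> mA mB iA iB; have mAB := measurableI _ _ mA mB.
rewrite !(prE Q) // -EFinM lee_fin; apply/ler_addgt0Pl => e e0.
have [s [C [mC sC AC]]] := approximable_measurable Q mA e0.
by have := harris_approximation mA mB mC iA iB sC; lra.
Qed.

End harris.

(** * The two bounds *)

Section tail_model.
Context (R : realType) (G : digraph) (Q : probability (config G) R) (q : R).
Context (Qq : bernoulli_site q Q) (q01 : 0 <= q <= 1).

Definition tail_config (w : config G) : config (edge G) := fun e => w (val e).1.

Lemma measurable_tail_config : measurable_fun setT tail_config.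
Proof. by apply: measurable_fun_config => e; exact: measurable_coordinate. Qed.

HB.instance Definition _ :=
  isMeasurableFun.Build _ _ _ _ tail_config measurable_tail_config.

Lemma measurable_tail_preimage (A : set (config (edge G))) :
  measurable A -> measurable (tail_config @^-1` A).
Proof.
by move=> mA; have := measurable_tail_config measurableT mA; rewrite setTI.
Qed.

Lemma tail_preimage_coordinates (F : set (edge G)) (A : set (config (edge G))) :
  <<s coordinate_events F >> A ->
  <<s coordinate_events [set (val e).1 | e in F] >> (tail_config @^-1` A).
Proof.
move=> sA.
pose T := g_sigma_algebraType (coordinate_events [set (val e).1 | e in F]).
have mf : @measurable_fun _ _ T (g_sigma_algebraType (coordinate_events F))
    setT tail_config.
  apply: measurable_fun_coordinates => e Fe; apply: sub_sigma_algebra.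
  by exists (val e).1 => //; exists e.
by have := mf measurableT _ sA; rewrite setTI.
Qed.

Lemma tail_model_Pa : Pa q (distribution Q tail_config).
Proof.
split.
- move=> A B mA mB iA iB; apply: (harris Qq q01).
  + exact: measurable_tail_preimage.
  + exact: measurable_tail_preimage.
  + by move=> w w' ww; apply: iA => e; exact: ww.
  + by move=> w w' ww; apply: iB => e; exact: ww.
- move=> F1 F2 _ F12 A1 A2 sA1 sA2.
  apply: (bernoulli_independent Qq) (tail_preimage_coordinates sA1)
    (tail_preimage_coordinates sA2).
  (* A common tail would be a shared vertex. *)
  apply/seteqP; split => // v [[e F1e <-] [f F2f ef]].
  by apply: (F12 e f F1e F2f); exact: Or41.
move=> e; rewrite /= /distribution /pushforward /=.
have := pr_site_history Qq (O := [:: (val e).1]) (C := [::]) isT.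
rewrite mulr1 expr1 => {1}<-; rewrite -prE; last exact: measurable_site_history.
rewrite (_ : site_history _ _ = tail_config @^-1` [set w | w e]) //.
by apply/seteqP; split => w; rewrite /site_history /tail_config /= !andbT.
Qed.

(** Along an open bond path all vertices except possibly the last are tails of open edges, hence
    open sites. *)
Lemma tail_bond_reachable (w : config G) (x y : G) :
  bond_reachable (tail_config w) x y ->
  y = x \/ exists2 z, site_reachable w x z & Defs.arc z y.
Proof.
move=> [s]; elim/last_ind: s y => [|s z IH] y /=; first by move=> _ <-; left.
rewrite last_rcons rcons_path => /andP[ps sz] <-; right.
have arcsz := open_arc_sub sz; exists (last x s) => //.
have wl : w (last x s).
  move: sz; rewrite /open_arc; case: insubP => // e _ ev.
  by rewrite /tail_config ev.
exists s; split => //.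
  by apply: sub_path ps => u v; exact: open_arc_sub.
elim: s x ps wl {IH sz arcsz} => [|v s IH] x /= ps wl; first by rewrite wl.
case/andP: ps => xv ps; apply/andP; split; last exact: IH.
move: xv; rewrite /open_arc; case: insubP => // e _ ev.
by rewrite /tail_config ev.
Qed.

End tail_model.

(** A finite site cluster has finitely many out-neighbours, and these together with [x] contain the
    bond cluster. *)
Lemma tail_percolation_sub (w : config directed_Z2) :
  bond_percolation_event (tail_config w) -> site_percolation_event w.
Proof.
move=> [x binf]; exists x => sfin; apply: binf.
apply: (@sub_finite_set _ _ ([set x] `|`
    ((fun z : directed_Z2 => lattice_point z 1 0) @` site_reachable w x `|`
     (fun z : directed_Z2 => lattice_point z 1 1) @` site_reachable w x))).
  move=> y /tail_bond_reachable[->|[z xz zy]]; first by left.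
  move: zy; rewrite -[z]lattice_point0 => /arc_lattice_point.
  by case=> ->; right; [left|right]; exists z.
rewrite !finite_setU; split; first exact: finite_set1.
by split; exact: finite_image.
Qed.

Lemma tail_model_nonpercolating (R : realType)
    (Q : probability (config directed_Z2) R) :
  Q (@site_percolation_event directed_Z2) = 0%E ->
  ~ bond_percolates (distribution Q (@tail_config directed_Z2)).
Proof.
move=> Q0; rewrite /bond_percolates /= /distribution /pushforward /=.
apply/negP; rewrite -leNgt -Q0; apply: le_measure; rewrite ?inE.
- have := @measurable_bond_percolation_event directed_Z2.
  exact: measurable_tail_preimage.
- exact: (@measurable_site_percolation_event directed_Z2).
by move=> w; exact: tail_percolation_sub.
Qed.

Theorem theorem5 (R : realType) :
  pc_site R directed_Z2 <= pa_plus R directed_Z2 /\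
  pa_plus R directed_Z2 <= Num.sqrt (pc_site R directed_Z2).
Proof.
rewrite /pc_site /pa_plus.
set S := [set p : R | _ /\ exists2 P, bernoulli_site p P & _].
set B := [set p : R | _ /\ exists2 P, Pa p P & _].
have SB : S `<=` B.
  move=> q [q01 [Q Qq Q0]]; split=> //.
  exists (distribution Q (@tail_config directed_Z2)).
    exact: tail_model_Pa.
  exact: tail_model_nonpercolating.
have ubS : has_ubound S by exists 1 => p [/andP[]].
have ubB : has_ubound B by exists 1 => p [/andP[]].
split.
  (* The supremum of the empty set is 0 by convention, and [B] has no negative elements. *)
  have [->|S0] := eqVneq S set0.
    rewrite sup0; have [->|/set0P[p Bp]] := eqVneq B set0.
      by rewrite sup0.
    by apply: le_trans (ub_le_sup ubB Bp); case: Bp => /andP[].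
  by apply: ge_sup; [exact/set0P|move=> p /SB; exact: ub_le_sup].
have [->|B0] := eqVneq B set0; first by rewrite sup0 sqrtr_ge0.
apply: ge_sup; first exact/set0P.
move=> p [p01 [P Pp nperc]]; have /andP[p0 p1] := p01.
have pp01 : 0 <= p * p <= 1 by rewrite mulr_ge0 // mulr_ile1.
have [Q Qp] := bernoulli_site_exists directed_Z2 pp01.
have Spp : S (p * p).
  by split=> //; exists Q => //; exact: site_percolation_null Pp nperc Qp.
(* As [p] is nonnegative, it is the square root of [p * p], an element of [S]. *)
rewrite -[p](ger0_norm p0) -sqrtr_sqr expr2 ler_sqrt; first exact: ub_le_sup.
by apply: le_trans (ub_le_sup ubS Spp); case/andP: pp01.
Qed.
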